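(* All IRSs of the first Grigorchuk group $\mathfrak{G}$ are co-sofic; the same conclusion holds for the Gupta–Sidki $p$-groups $G_p$, for every prime $p\ge3$.
   Context: An IRS of a countable group $G$ is a Borel probability measure on $\mathrm{Sub}(G)\subset\{0,1\}^G$ (product topology) invariant under conjugation by $G$. An IRS is co-sofic if it is a weak-$*$ limit of IRSs supported on finite index subgroups of $G$. Automorphisms of the $q$-regular rooted tree (vertices: finite words over $\{0,\ldots,q-1\}$) act on the right. We write $g=(g_0,\ldots,g_{q-1})\sigma$ if $(vw)\cdot g=(v\cdot\sigma)(w\cdot g_v)$ for every letter $v$ and word $w$; a permutation $\sigma$ alone denotes the rooted automorphism with all $g_v=1$, and $\sigma$ is omitted when trivial. The first Grigorchuk group $\mathfrak{G}$ is the group of automorphisms of the binary rooted tree generated by $a,b,c,d$, where $a=\varepsilon$ (the permutation exchanging the two subtrees of the root), $b=(a,c)$, $c=(a,d)$, $d=(1,b)$. For a prime $p\ge3$, the Gupta–Sidki $p$-group $G_p$ is the group of automorphisms of the $p$-regular rooted tree generated by $a=\sigma$, the rooted automorphism given by the cyclic permutation $\sigma$ of $\{0,1,\ldots,p-1\}$, and $t=(a,a^{-1},1,\ldots,1,t)$. *)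

(* Defs.v *)
From HB Require Import structures.
From mathcomp Require Import all_boot all_order all_algebra all_fingroup.
From mathcomp Require Import all_classical all_reals all_analysis.
Import numFieldNormedType.Exports.

Set Implicit Arguments.
Unset Strict Implicit.
Unset Printing Implicit Defensive.

Local Open Scope classical_set_scope.
Local Open Scope group_scope.

(* A subset of G is a point of G -> bool, with the product of the discrete
   topologies; subgroup_space G carries the subspace topology of set_type. *)
Definition subgroup_set (G : groupType) :
    set (prod_topology (fun _ : G => bool)) :=
  [set H | group_closed (H : {pred G})].
Arguments subgroup_set : clear implicits.

Definition subgroup_space (G : groupType) : Type := set_type (subgroup_set G).

HB.instance Definition _ (G : groupType) :=
  Topological.copy (subgroup_space G) (set_type (subgroup_set G)).

Lemma full_subgroup (G : groupType) :
  (fun _ => true : bool) \in subgroup_set G.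
Proof. by apply/mem_set; split. Qed.

HB.instance Definition _ (G : groupType) :=
  isPointed.Build (subgroup_space G)
    (exist (fun H => H \in subgroup_set G) _ (full_subgroup G)).

Definition mem_sub (G : groupType) (H : subgroup_space G) : {pred G} := val H.

Definition BorelSub (G : groupType) :=
  g_sigma_algebraType (@open (subgroup_space G)).

Lemma conj_subgroup (G : groupType) (g : G) (H : subgroup_space G) :
  (fun x : G => (x ^ g^-1) \in mem_sub H) \in subgroup_set G.
Proof.
case: H => H HG; have [H1 HF] : group_closed (H : {pred G}) := set_mem HG.
apply/mem_set; split => [|x y].
  by rewrite unfold_in /mem_sub conj1g.
rewrite !unfold_in => Hx Hy.
by rewrite conjMg conjVg; apply: HF.
Qed.

(* The conjugate g^-1 H g. *)
Definition conj_sub (G : groupType) (g : G) (H : subgroup_space G) :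
    subgroup_space G :=
  exist (fun K => K \in subgroup_set G) _ (conj_subgroup g H).

Definition is_IRS (R : realType) (G : groupType)
    (mu : probability (BorelSub G) R) : Prop :=
  forall (g : G) (A : set (BorelSub G)), measurable A ->
    mu (conj_sub g @^-1` A) = mu A.

(* y x^-1 \in H says that y lies in the right coset H x. *)
Definition finite_index (G : groupType) (H : subgroup_space G) : Prop :=
  finite_set (range (fun x : G => [set y : G | y * x^-1 \in mem_sub H])).

(* As subgroup_space G is compact, every continuous f is bounded. For countable
   G, subgroup_space G is moreover metrizable, hence so is the weak-* topology
   on its probability measures, and limits of sequences are the same as limits
   of nets. *)
Definition weak_star_cvg (R : realType) (G : groupType)
    (nu : nat -> probability (BorelSub G) R)
    (mu : probability (BorelSub G) R) : Prop :=
  forall f : subgroup_space G -> R, continuous f ->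
    (fun n => (\int[nu n]_(H in setT) f H)%R) @ \oo
      --> (\int[mu]_(H in setT) f H)%R.

Definition cosofic (R : realType) (G : groupType)
    (mu : probability (BorelSub G) R) : Prop :=
  exists nu : nat -> probability (BorelSub G) R,
    [/\ forall n, is_IRS (nu n),
        forall n, {ae nu n, forall H : BorelSub G, finite_index H}
      & weak_star_cvg nu mu].

Definition generated (Gam : groupType) (S : set Gam) : {pred Gam} :=
  fun g => `[< forall K : {pred Gam}, group_closed K ->
                 (forall s, S s -> s \in K) -> g \in K >].

Lemma generated_group_closed (Gam : groupType) (S : set Gam) :
  group_closed (generated S).
Proof.
split; first by apply/asboolP => K [].
move=> x y /asboolP Sx /asboolP Sy; apply/asboolP => K KG SK.
by apply: KG.2; [exact: Sx | exact: Sy].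
Qed.

Definition gen_group (Gam : groupType) (S : set Gam) : Type :=
  {g : Gam | g \in generated S}.

HB.instance Definition _ (Gam : groupType) (S : set Gam) :=
  SubChoice.copy (gen_group S) {g : Gam | g \in generated S}.
HB.instance Definition _ (Gam : groupType) (S : set Gam) :=
  SubChoice_isSubGroup.Build Gam (generated S) (gen_group S)
    (generated_group_closed S).

Definition child (q : nat) (u v : seq 'I_q) : Prop :=
  exists x, v = rcons u x.

Definition is_tree_aut (q : nat) (f : seq 'I_q -> seq 'I_q) : Prop :=
  [/\ bijective f, f [::] = [::] & forall u v, child (f u) (f v) <-> child u v].

Record tree_aut (q : nat) := TreeAut {
  tree_aut_fun :> seq 'I_q -> seq 'I_q;
  tree_autP : `[< is_tree_aut tree_aut_fun >]
}.

HB.instance Definition _ (q : nat) := [isSub for @tree_aut_fun q].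
HB.instance Definition _ (q : nat) := [Choice of tree_aut q by <:].

Section TreeAutGroup.
Variable q : nat.
Implicit Types f g h : tree_aut q.

Lemma tree_aut_ext f g : f =1 g -> f = g.
Proof. by move=> fg; apply/val_inj/funext. Qed.

Lemma tree_aut_id_proof : `[< is_tree_aut (@id (seq 'I_q)) >].
Proof. by apply/asboolP; split => //; exists id. Qed.

Lemma tree_aut_mul_proof f g : `[< is_tree_aut (fun w => g (f w)) >].
Proof.
case: f g => f /= /asboolP [bf f0 fc] [g /= /asboolP [bg g0 gc]].
apply/asboolP; split; [exact: (bij_comp bg bf) | by rewrite f0 g0 |].
by move=> u v; rewrite gc fc.
Qed.

Lemma tree_aut_inv_ex f : exists g : seq 'I_q -> seq 'I_q,
  [/\ cancel f g, cancel g f & `[< is_tree_aut g >]].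
Proof.
case: f => f /= /asboolP [[g fK gK] f0 fc].
exists g; split => //; apply/asboolP; split.
- by exists f.
- by rewrite -f0 fK.
- by move=> u v; rewrite -fc !gK.
Qed.

Definition tree_aut_id := TreeAut tree_aut_id_proof.

(* Automorphisms act on the right: w . (f g) = (w . f) . g. *)
Definition tree_aut_mul f g := TreeAut (tree_aut_mul_proof f g).

Definition tree_aut_inv f : tree_aut q :=
  let: exist g Hg := cid (tree_aut_inv_ex f) in
  let: And3 _ _ gP := Hg in TreeAut gP.

Lemma tree_aut_invK f : cancel f (tree_aut_inv f).
Proof. by rewrite /tree_aut_inv; case: cid => g [fK gK gP] /=. Qed.

Lemma tree_aut_Kinv f : cancel (tree_aut_inv f) f.
Proof. by rewrite /tree_aut_inv; case: cid => g [fK gK gP] /=. Qed.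

Lemma tree_aut_mulA : associative tree_aut_mul.
Proof. by move=> f g h; exact: tree_aut_ext. Qed.
Lemma tree_aut_1mul : left_id tree_aut_id tree_aut_mul.
Proof. by move=> f; exact: tree_aut_ext. Qed.
Lemma tree_aut_mul1 : right_id tree_aut_id tree_aut_mul.
Proof. by move=> f; exact: tree_aut_ext. Qed.
Lemma tree_aut_Vmul : left_inverse tree_aut_id tree_aut_inv tree_aut_mul.
Proof. by move=> f; apply: tree_aut_ext; exact: tree_aut_Kinv. Qed.
Lemma tree_aut_mulV : right_inverse tree_aut_id tree_aut_inv tree_aut_mul.
Proof. by move=> f; apply: tree_aut_ext; exact: tree_aut_invK. Qed.

End TreeAutGroup.

HB.instance Definition _ (q : nat) := isGroup.Build (tree_aut q)
  (@tree_aut_mulA q) (@tree_aut_1mul q) (@tree_aut_mul1 q)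
  (@tree_aut_Vmul q) (@tree_aut_mulV q).

Section Wreath.
Variable q : nat.

Definition wreath_fun (gs : 'I_q -> seq 'I_q -> seq 'I_q) (s : 'S_q)
    (u : seq 'I_q) : seq 'I_q :=
  if u is v :: w then s v :: gs v w else [::].

Lemma wreath_proof (gs : 'I_q -> tree_aut q) (s : 'S_q) :
  `[< is_tree_aut (wreath_fun gs s) >].
Proof.
apply/asboolP; split => //.
- exists (fun u => if u is v :: w
                   then (s^-1)%g v :: (gs ((s^-1)%g v))^-1%g w else [::]).
    by case=> [|v w] //=; rewrite permK (tree_aut_invK (gs v) w).
  case=> [|v w] //=.
  by rewrite permKV (tree_aut_Kinv (gs ((s^-1)%g v)) w).
- have childE (x y : 'I_q) (u v : seq 'I_q) :
      child (x :: u) (y :: v) <-> x = y /\ child u v.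
    split; first by case=> z [-> ->]; split => //; exists z.
    by case=> -> [z ->]; exists z.
  case=> [|x u] [|y v] //=.
  + have /asboolP [gb g0 _] := tree_autP (gs y).
    split=> -[z /= [_ e]]; last by exists (s y); rewrite e g0.
    by exists y; rewrite (bij_inj gb (etrans e (esym g0))).
  + by split; case=> z.
  + rewrite !childE; split=> [[/perm_inj <-]|[<-]] guv; split => //.
      by have /asboolP [_ _ gc] := tree_autP (gs x); apply/gc.
    by have /asboolP [_ _ gc] := tree_autP (gs x); apply/gc.
Qed.

(* g = (g_0, ..., g_(q-1)) s: (v w) . g = (v . s) (w . g_v). *)
Definition wreath (gs : 'I_q -> tree_aut q) (s : 'S_q) : tree_aut q :=
  TreeAut (wreath_proof gs s).

Definition rooted (s : 'S_q) : tree_aut q := wreath (fun _ => 1) s.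

End Wreath.

(* Tree automorphisms defined by mutual wreath recursion: the family
   g_x = (g_(next x 0), ..., g_(next x (q-1))) (out x), x ranging over St;
   see mealyE. *)
Section Mealy.
Variables (q : nat) (St : Type) (out : St -> 'S_q) (next : St -> 'I_q -> St).

Fixpoint mealy_fun (x : St) (u : seq 'I_q) : seq 'I_q :=
  if u is v :: w then out x v :: mealy_fun (next x v) w else [::].

Lemma mealy_proof (x : St) : `[< is_tree_aut (mealy_fun x) >].
Proof.
pose fix inv_fun (x : St) (u : seq 'I_q) : seq 'I_q :=
  if u is v :: w then
    let v' := ((out x)^-1)%g v in v' :: inv_fun (next x v') w else [::].
have fK y : cancel (mealy_fun y) (inv_fun y).
  by move=> u; elim: u y => [|v w IH] y //=; rewrite permK IH.
have Kf y : cancel (inv_fun y) (mealy_fun y).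
  by move=> u; elim: u y => [|v w IH] y //=; rewrite permKV IH.
have f_rcons y u v :
    exists z, mealy_fun y (rcons u v) = rcons (mealy_fun y u) z.
  elim: u y => [|w u IH] y /=; first by exists (out y v).
  by have [z ->] := IH (next y w); exists z.
have i_rcons y u v : exists z, inv_fun y (rcons u v) = rcons (inv_fun y u) z.
  elim: u y => [|w u IH] y /=; first by exists (((out y)^-1)%g v).
  by have [z ->] := IH (next y (((out y)^-1)%g w)); exists z.
apply/asboolP; split => //; first by exists (inv_fun x).
move=> u v; split=> [[z e]|[z ->]]; last exact: f_rcons.
by rewrite -[v](fK x) e -[in X in child X _](fK x u); exact: i_rcons.
Qed.

Definition mealy (x : St) : tree_aut q := TreeAut (mealy_proof x).

Lemma mealyE (x : St) : mealy x = wreath (fun v => mealy (next x v)) (out x).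
Proof. by apply: tree_aut_ext; case. Qed.

End Mealy.

(* i |-> i + 1 mod q *)
Definition cycle_perm (q : nat) : 'S_q := perm (@ordS_inj q).

Definition pair_fun (T : Type) (x y : T) : 'I_2 -> T :=
  fun v => if v == ord0 then x else y.

Inductive grig_state := G1 | Ga | Gb | Gc | Gd.

Definition grig_out (x : grig_state) : 'S_2 :=
  if x is Ga then tperm ord0 ord_max else 1.

Definition grig_next (x : grig_state) : 'I_2 -> grig_state :=
  match x with
  | G1 | Ga => fun _ => G1
  | Gb => pair_fun Ga Gc
  | Gc => pair_fun Ga Gd
  | Gd => pair_fun G1 Gb
  end.

Definition grig (x : grig_state) : tree_aut 2 := mealy grig_out grig_next x.

Definition grig_a := grig Ga.
Definition grig_b := grig Gb.
Definition grig_c := grig Gc.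
Definition grig_d := grig Gd.

Lemma grig1E : grig G1 = 1.
Proof.
by apply: tree_aut_ext; elim=> [|v w IH] //=; rewrite perm1 [X in _ :: X]IH.
Qed.

Lemma pair_funE (T U : Type) (f : T -> U) (x y : T) :
  (fun v => f (pair_fun x y v)) = pair_fun (f x) (f y).
Proof. by apply/funext => v; rewrite /pair_fun; case: ifP. Qed.

Lemma grig_aE : grig_a = rooted (tperm ord0 ord_max).
Proof. by rewrite /grig_a /grig mealyE /= -/(grig G1) grig1E. Qed.

Lemma grig_bE : grig_b = wreath (pair_fun grig_a grig_c) 1.
Proof. by rewrite /grig_b /grig mealyE /= (pair_funE (mealy _ _)). Qed.

Lemma grig_cE : grig_c = wreath (pair_fun grig_a grig_d) 1.
Proof. by rewrite /grig_c /grig mealyE /= (pair_funE (mealy _ _)). Qed.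

Lemma grig_dE : grig_d = wreath (pair_fun 1 grig_b) 1.
Proof. by rewrite -grig1E /grig_d /grig mealyE /= (pair_funE (mealy _ _)). Qed.

Definition Grigorchuk : groupType :=
  gen_group [set g | [\/ g = grig_a, g = grig_b, g = grig_c | g = grig_d]].

(* (x, y, 1, ..., 1, z), of length p *)
Definition gs_tuple (p : nat) (T : Type) (one x y z : T) : 'I_p -> T :=
  fun v => if v == 0%N :> nat then x else if v == 1%N :> nat then y
           else if v == p.-1 :> nat then z else one.

Inductive gs_state := S1 | Sa | SaV | St.

Definition gs_out (p : nat) (x : gs_state) : 'S_p :=
  match x with
  | Sa => cycle_perm p
  | SaV => (cycle_perm p)^-1
  | S1 | St => 1
  end.

Definition gs_next (p : nat) (x : gs_state) : 'I_p -> gs_state :=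
  if x is St then gs_tuple S1 Sa SaV St else fun _ => S1.

Definition gs (p : nat) (x : gs_state) : tree_aut p :=
  mealy (gs_out p) (@gs_next p) x.

Definition gs_a (p : nat) := gs p Sa.
Definition gs_t (p : nat) := gs p St.

Lemma gs1E (p : nat) : gs p S1 = 1.
Proof.
by apply: tree_aut_ext; elim=> [|v w IH] //=; rewrite perm1 [X in _ :: X]IH.
Qed.

Lemma gs_aE (p : nat) : gs_a p = rooted (cycle_perm p).
Proof. by rewrite /gs_a /gs mealyE /= -/(gs p S1) gs1E. Qed.

Lemma gs_aVE (p : nat) : gs p SaV = (gs_a p)^-1.
Proof.
apply: (mulgI (gs_a p)); rewrite mulgV gs_aE /gs mealyE /= -/(gs p S1) gs1E.
by apply: tree_aut_ext; case=> [|v w] //=; rewrite permK.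
Qed.

Lemma gs_tE (p : nat) :
  gs_t p = wreath (gs_tuple 1 (gs_a p) (gs_a p)^-1 (gs_t p)) 1.
Proof.
rewrite -gs_aVE -gs1E [LHS]mealyE /=; congr wreath.
by apply/funext => v; rewrite /gs_tuple; do 3!case: ifP => // _.
Qed.

Definition GuptaSidki (p : nat) : groupType :=
  gen_group [set g | g = gs_a p \/ g = gs_t p].

(* Main.v *)
(* For an IRS H let T be the random set of vertices v such that, at every depth
   below v, some copy of a regular branching subgroup K is not contained in H.

   If h in H moves a vertex v, then invariance of H under the copy of K acting
   below h(v), together with Borel-Cantelli, shows that H almost surely projects
   onto a finite index subgroup of the copy of K below v.  Double commutators
   turn this into copies of K inside H at all vertices far enough below v; hence
   H fixes T pointwise.

   By invariance the probability that a given ray lies in T while infinitely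
   many siblings of its vertices do not is 0.  As nontrivial germs of elements of
   the groups at fixed rays produce such siblings, an element of the group that
   fixes T pointwise almost surely acts trivially near T.

   Let A_n(H) consist of the elements of H that act trivially below each level n
   vertex v such that the copy of K at v is not in H, and let N_n be the product
   of the copies of K at level n, a normal subgroup of finite index.  Then
   H |-> A_n(H) N_n is equivariant, and the two facts above show that A_n(H) N_n
   converges almost surely to H; its laws are the desired IRSs. *)

Require Import Defs.
From mathcomp Require Import all_boot all_order all_algebra all_fingroup.
From mathcomp Require Import all_classical all_reals all_analysis.
From mathcomp Require Import measurable_realfun.
Import Order.TTheory GRing.Theory Num.Theory.
Import numFieldNormedType.Exports.

Set Implicit Arguments.
Unset Strict Implicit.
Unset Printing Implicit Defensive.

Local Open Scope classical_set_scope.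
Local Open Scope group_scope.

(** * Sections of tree automorphisms *)

(** The Borel-Cantelli argument handles one pair [(v, h)] at a time and the ray argument one ray at
    a time, so almost sure statements need countably many cases. For rays this is the purpose of
    [spinal]: a germ that is nontrivial at bad vertices of every depth can only sit on a ray ending
    in [om om ...]. The ray estimate rests on transitivity: the [q] children of a vertex are equally
    likely to continue the ray, and at a level with a hole not all of them do, so each such level
    costs a factor [1 - 1/q]. Commutators only produce elements of [[K, K]]; hence the constant
    [m0], a depth at which copies of [K] lie in [[K, K]]. One level enters [[K, Gam]], and each
    round of sections needed for [K] to cover the group adds one: [1 + 3] for the Grigorchuk group,
    [1 + 1] for the Gupta-Sidki groups. At depth [m1], here 2, every vertex is moved by some element
    of [K]. Subgroups are handled as sets of arbitrary tree automorphisms, so that copies and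
    sections can be taken freely; [carrier] translates from points of the space of subgroups. *)

Record subgrp (G : groupType) (P : set G) : Prop := Subgrp {
  sg1 : P 1;
  sgM : forall x y, P x -> P y -> P (x * y);
  sgV : forall x, P x -> P x^-1 }.

Section SubgrpTheory.
Variable G : groupType.
Implicit Types (x y : G) (P : set G).

Lemma sgMl P x y : subgrp P -> P x -> P (x * y) = P y.
Proof.
move=> sP Px; apply/propext; split; last exact: sgM.
by move=> Pxy; rewrite -(mulKg x y); apply: sgM => //; exact: sgV.
Qed.

Lemma sgJ P x y : subgrp P -> P x -> P y -> P (x ^ y).
Proof. by move=> sP Px Py; do 2?apply: sgM => //; exact: sgV. Qed.

Lemma sgX P x n : subgrp P -> P x -> P (x ^+ n).
Proof.
move=> sP Px; elim: n => [|n IH]; first by rewrite expg0; exact: sg1.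
by rewrite expgS; exact: sgM.
Qed.

Lemma sgR P x y : subgrp P -> P x -> P y -> P [~ x, y].
Proof. by move=> sP Px Py; apply: sgM; [|exact: sgV|exact: sgJ]. Qed.

End SubgrpTheory.

Section Sections.
Variable q : nat.
Implicit Types (f g h : tree_aut q) (u v w : seq 'I_q).

Lemma mulgE f g w : (f * g) w = g (f w). Proof. by []. Qed.
Lemma one_autE w : (1 : tree_aut q) w = w. Proof. by []. Qed.
Lemma autK f : cancel f (f^-1)%g. Proof. exact: tree_aut_invK. Qed.
Lemma autKV f : cancel (f^-1)%g f. Proof. exact: tree_aut_Kinv. Qed.
Lemma aut_inj f : injective f. Proof. exact: can_inj (autK f). Qed.

Lemma aut_nil f : f [::] = [::].
Proof. by have /asboolP [] := tree_autP f. Qed.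

Lemma aut_rcons f u x : exists y, f (rcons u x) = rcons (f u) y.
Proof.
have /asboolP [_ _ fc] := tree_autP f.
by have /fc : child u (rcons u x) by exists x.
Qed.

Lemma size_aut f u : size (f u) = size u.
Proof.
elim/last_ind: u => [|u x IH]; first by rewrite aut_nil.
by have [y ->] := aut_rcons f u x; rewrite !size_rcons IH.
Qed.

Definition sec_fun f u w := drop (size u) (f (u ++ w)).

Lemma aut_cat_fun f u v : f (u ++ v) = f u ++ sec_fun f u v.
Proof.
rewrite -[LHS](cat_take_drop (size u)); congr cat.
elim/last_ind: v => [|v x IH]; first by rewrite cats0 -(size_aut f) take_size.
rewrite -rcons_cat; have [y ->] := aut_rcons f (u ++ v) x.
by rewrite -cats1 takel_cat // size_aut size_cat leq_addr.
Qed.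

Lemma sec_funK f u : cancel (sec_fun f u) (sec_fun (f^-1)%g (f u)).
Proof.
by move=> w; rewrite /sec_fun -aut_cat_fun autK size_aut drop_size_cat.
Qed.

Lemma child_cat u v w : child (u ++ v) (u ++ w) <-> child v w.
Proof.
split=> [[x e]|[x ->]]; last by exists x; rewrite rcons_cat.
by exists x; move/eqP: e; rewrite rcons_cat eqseq_cat // eqxx => /eqP.
Qed.

Lemma sec_proof f u : `[< is_tree_aut (sec_fun f u) >].
Proof.
apply/asboolP; split.
- exists (sec_fun (f^-1)%g (f u)); first exact: sec_funK.
  by move=> w; have := sec_funK (f^-1)%g (f u) w; rewrite autK invgK.
- by rewrite /sec_fun cats0 -(size_aut f) drop_size.
- move=> v w; rewrite -(child_cat (f u)) -!aut_cat_fun.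
  by have /asboolP [_ _ ->] := tree_autP f; exact: child_cat.
Qed.

(* The section g_u: (u v) . g = (u . g) (v . g_u). *)
Definition sec f u : tree_aut q := TreeAut (sec_proof f u).

Lemma aut_cat f u v : f (u ++ v) = f u ++ sec f u v.
Proof. exact: aut_cat_fun. Qed.

Lemma secP f g u : (forall v, f (u ++ v) = f u ++ g v) -> sec f u = g.
Proof.
move=> fg; apply: tree_aut_ext => v.
by have /eqP := fg v; rewrite aut_cat eqseq_cat // eqxx => /eqP.
Qed.

Lemma sec1 u : sec 1 u = 1.
Proof. exact: secP. Qed.

Lemma secM f g u : sec (f * g) u = sec f u * sec g (f u).
Proof. by apply: secP => v; rewrite !mulgE !aut_cat. Qed.

Lemma secV f u : sec (f^-1)%g (f u) = (sec f u)^-1.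
Proof.
by apply: (mulgI (sec f u)); rewrite mulgV -secM mulgV sec1.
Qed.

Lemma sec_nil f : sec f [::] = f.
Proof. by apply: secP => v; rewrite aut_nil. Qed.

Lemma sec_cat f u v : sec f (u ++ v) = sec (sec f u) v.
Proof. by apply: secP => w; rewrite -catA !aut_cat catA. Qed.

Lemma aut_take f n u : f (take n u) = take n (f u).
Proof.
have [lenu|ltun] := leqP n (size u); last first.
  by rewrite !take_oversize ?size_aut // ltnW.
rewrite -{2}(cat_take_drop n u) aut_cat take_size_cat //.
by rewrite size_aut size_takel.
Qed.

Lemma sec_wreath (gs : 'I_q -> tree_aut q) s i : sec (wreath gs s) [:: i] = gs i.
Proof. by apply: secP => v /=; rewrite aut_nil. Qed.

Lemma wreath1E (gs : 'I_q -> tree_aut q) s i : wreath gs s [:: i] = [:: s i].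
Proof. by rewrite /= aut_nil. Qed.

Lemma autE_cons f i u : f (i :: u) = f [:: i] ++ sec f [:: i] u.
Proof. by rewrite -cat1s aut_cat. Qed.

Lemma aut_letter f i : exists j, f [:: i] = [:: j].
Proof.
have := size_aut f [:: i]; case: (f [:: i]) => [|j [|? ?]] //= _.
by exists j.
Qed.

Lemma eq_aut_sec f g : (forall i, f [:: i] = g [:: i]) ->
  (forall i, sec f [:: i] = sec g [:: i]) -> f = g.
Proof.
move=> fg sfg; apply: tree_aut_ext => -[|i u]; first by rewrite !aut_nil.
by rewrite autE_cons fg sfg -autE_cons.
Qed.

Lemma wreath1M (gs hs : 'I_q -> tree_aut q) :
  wreath gs 1 * wreath hs 1 = wreath (fun i => gs i * hs i) 1.
Proof.
apply: eq_aut_sec => i; first by rewrite mulgE !wreath1E !perm1.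
by rewrite secM !sec_wreath wreath1E perm1 sec_wreath.
Qed.

Lemma wreath1_1 : wreath (fun _ => 1) 1 = 1 :> tree_aut q.
Proof.
apply: eq_aut_sec => i; first by rewrite wreath1E perm1.
by rewrite sec_wreath sec1.
Qed.

Lemma wreath1V (gs : 'I_q -> tree_aut q) :
  (wreath gs 1)^-1 = wreath (fun i => (gs i)^-1) 1.
Proof.
apply: (mulgI (wreath gs 1)); rewrite mulgV wreath1M -wreath1_1.
by congr wreath; apply/funext => i; rewrite mulgV.
Qed.

Lemma wreath1R (gs hs : 'I_q -> tree_aut q) :
  [~ wreath gs 1, wreath hs 1] = wreath (fun i => [~ gs i, hs i]) 1.
Proof. by rewrite commgEl conjgE !wreath1V !wreath1M. Qed.

Lemma fix_letters_wreath f : (forall i, f [:: i] = [:: i]) ->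
  f = wreath (fun i => sec f [:: i]) 1.
Proof.
move=> ff; apply: eq_aut_sec => i; first by rewrite wreath1E perm1.
by rewrite sec_wreath.
Qed.

(** The image of [emb w] is the rigid stabilizer of [w] in the whole automorphism group; [emb w k]
    is the copy of [k] at [w]. *)
Fixpoint emb w g : tree_aut q :=
  if w is i :: w' then wreath (fun j => if j == i then emb w' g else 1) 1 else g.

Lemma emb_cat u w g : emb (u ++ w) g = emb u (emb w g).
Proof. by elim: u => [|i u IH] //=; rewrite IH. Qed.

Lemma embM w g h : emb w (g * h) = emb w g * emb w h.
Proof.
elim: w => [|i w IH] //=; rewrite wreath1M IH; congr wreath; apply/funext => j.
by case: ifP; rewrite ?mulg1.
Qed.

Lemma emb1 w : emb w 1 = 1.
Proof. by apply: (mulgI (emb w 1)); rewrite -embM !mulg1. Qed.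

Lemma embV w g : emb w g^-1 = (emb w g)^-1.
Proof. by apply: (mulgI (emb w g)); rewrite -embM !mulgV emb1. Qed.

Lemma embR w g h : emb w [~ g, h] = [~ emb w g, emb w h].
Proof. by rewrite !commgEl !conjgE !embM !embV. Qed.

Lemma emb_act w g v : emb w g (w ++ v) = w ++ g v.
Proof.
by elim: w => [|i w IH] //=; rewrite perm1 eqxx IH.
Qed.

Lemma emb_fix w g v : ~~ prefix w v -> emb w g v = v.
Proof.
elim: w v => [|i w IH] [|j v] //=; rewrite perm1.
by rewrite eq_sym; case: eqP => //= _ /IH ->.
Qed.

Lemma embE w g v :
  emb w g v = if prefix w v then w ++ g (drop (size w) v) else v.
Proof.
case: ifP => [/prefixP [v' ->]|/negbT /emb_fix //].
by rewrite emb_act drop_size_cat.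
Qed.

Lemma emb_self w g : emb w g w = w.
Proof. by rewrite -{2}(cats0 w) emb_act aut_nil cats0. Qed.

Lemma emb_le w g v : (size v <= size w)%N -> emb w g v = v.
Proof.
move=> le; have [/eqP vw|] := boolP (v == w); first by rewrite vw emb_self.
move=> ne; apply: emb_fix; apply/negP => /prefixP [x ex].
move: le ne; rewrite ex size_cat; case: x {ex} => [|a x]; first by rewrite cats0 eqxx.
by rewrite /= addnS ltnNge leq_addr.
Qed.

Lemma sec_emb w g : sec (emb w g) w = g.
Proof. by apply: secP => v; rewrite emb_act emb_self. Qed.

Lemma sec_emb1 w g u : ~~ prefix w u -> ~~ prefix u w -> sec (emb w g) u = 1.
Proof.
move=> wu uw; apply: secP => v; rewrite (emb_fix g wu) one_autE emb_fix //.
apply: contra wu; elim: w u uw => [|i w IH] [|j u] //=.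
by rewrite eq_sym; case: (i == j) => //=; exact: IH.
Qed.

Lemma prefix_aut f u v : prefix (f u) (f v) = prefix u v.
Proof.
suff H g x y : prefix x y -> prefix (g x) (g y).
  by apply/idP/idP => [/(H (f^-1)%g)|/H //]; rewrite !autK.
by move=> /prefixP [z ->]; rewrite aut_cat prefix_prefix.
Qed.

(** Together with normality of [K] and self-similarity, this makes the system of copies of [K]
    invariant under the group, which is behind every equivariance statement below. *)
Lemma embJ w g f : (emb w g) ^ f = emb (f w) (g ^ sec f w).
Proof.
apply: tree_aut_ext => x; rewrite conjgE !mulgE -{2}(autKV f x).
move: (f^-1 x) => z; rewrite !embE prefix_aut; case: ifP => // /prefixP [y ->].
rewrite drop_size_cat // !aut_cat drop_size_cat // conjgE !mulgE.
by rewrite autK.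
Qed.

Lemma emb_commute u v g h : ~~ prefix u v -> ~~ prefix v u ->
  commute (emb u g) (emb v h).
Proof.
by move=> uv vu; rewrite /commute conjgC embJ emb_fix // sec_emb1 // conjg1.
Qed.

Lemma prefix_eqsize u v : size u = size v -> prefix u v = (u == v).
Proof.
elim: u v => [|x u IH] [|y v] //= [/IH ->]; by rewrite eqseq_cons.
Qed.

Lemma emb_commute_eqsize u v g h : size u = size v -> u != v ->
  commute (emb u g) (emb v h).
Proof.
by move=> s ne; apply: emb_commute; rewrite prefix_eqsize ?s // eq_sym.
Qed.

Lemma wreath1_sub (P : set (tree_aut q)) (gs : 'I_q -> tree_aut q) :
  subgrp P -> (forall i, P (emb [:: i] (gs i))) -> P (wreath gs 1).
Proof.
move=> sP Pg.
(* The coordinates are inserted one letter at a time. *)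
suff H n : P (wreath (fun i => if (i < n)%N then gs i else 1) 1).
  have := H q; congr P; congr wreath; apply/funext => i.
  by rewrite ltn_ord.
elim: n => [|n IH]; first by rewrite wreath1_1; exact: sg1.
have [qn|nq] := leqP q n.
  move: IH; congr P; congr wreath; apply/funext => i.
  by have iq := leq_trans (ltn_ord i) qn; rewrite iq ltnS ltnW.
suff -> : wreath (fun i => if (i < n.+1)%N then gs i else 1) 1 =
    wreath (fun i => if (i < n)%N then gs i else 1) 1 *
    emb [:: Ordinal nq] (gs (Ordinal nq)) by apply: sgM.
rewrite /= wreath1M; congr wreath; apply/funext => i.
rewrite ltnS leq_eqVlt -val_eqE /=; case: eqP => /= [e|_]; last by rewrite mulg1.
by rewrite e ltnn mul1g; congr gs; apply/val_inj.
Qed.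

(** An automorphism fixing level [n] is the product of the copies of its sections there. The
    induction replaces [P] by its preimage under [emb [:: i]], so the product is never written
    out. *)
Lemma prod_sec_sub (P : set (tree_aut q)) n f : subgrp P ->
  (forall u, size u = n -> f u = u) ->
  (forall u, size u = n -> P (emb u (sec f u))) -> P f.
Proof.
elim: n P f => [|n IH] P f sP ff Pf.
  by rewrite -[f]sec_nil; exact: (Pf [::]).
have f1 i : f [:: i] = [:: i].
  have := aut_take f 1 (i :: nseq n i); rewrite (ff (i :: nseq n i));
    last by rewrite /= size_nseq.
  by rewrite /= take0.
rewrite [f](fix_letters_wreath f1); apply: wreath1_sub => // i.
apply: (IH (fun g => P (emb [:: i] g))).
- split; first by rewrite emb1; exact: sg1.
    by move=> x y; rewrite embM; exact: sgM.
  by move=> x; rewrite embV; exact: sgV.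
- move=> u su; have := ff (i :: u); rewrite /= su => /(_ erefl).
  by rewrite autE_cons f1 => -[].
- move=> u su; have := Pf (i :: u) (congr1 S su).
  by rewrite -cat1s emb_cat sec_cat.
Qed.

End Sections.

(** * Branch groups acting on a rooted tree *)

(* For a subgroup L of A this says that L has finite index in A. *)
Definition fin_idx (G : groupType) (A L : set G) : Prop :=
  exists (C : finType) (c : G -> C),
    forall x y, A x -> A y -> c x = c y -> L (x * y^-1).

Lemma fin_idx_reps (G : groupType) (A L : set G) : A 1 -> fin_idx A L ->
  exists (C : finType) (c : G -> C) (rep : C -> G),
    [/\ forall x y, A x -> A y -> c x = c y -> L (x * y^-1),
        forall i, A (rep i) &
        forall x, A x -> L (x * (rep (c x))^-1)].
Proof.
move=> A1 [C [c cP]].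
have [rep repP] : {rep : C -> G & forall i, A (rep i) /\
    ((exists2 x, A x & c x = i) -> c (rep i) = i)}.
  apply: (@choice _ _ (fun i r => A r /\ ((exists2 x, A x & c x = i) -> c r = i))) => i.
  have [[x Ax cx]|ne] := pselect (exists2 x, A x & c x = i); first by exists x.
  by exists 1.
exists C, c, rep; split => // [i|x Ax]; first by have [] := repP i.
apply: cP => //; first by have [] := repP (c x).
by have [_ ->] := repP (c x) => //; exists x.
Qed.

Lemma words_uniform (I : finType) n (P : seq I -> nat -> Prop) :
  (forall u m m', (m <= m')%N -> P u m -> P u m') ->
  (forall u, size u = n -> exists m, P u m) ->
  exists m, forall u, size u = n -> P u m.
Proof.
move=> mono ex.
have [f fP] : {f : n.-tuple I -> nat & forall t, P (val t) (f t)}.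
  by apply: (@choice _ _ (fun t : n.-tuple I => P (val t))) => t; apply: ex;
    rewrite size_tuple.
exists (\max_(t : n.-tuple I) f t)%N => u /eqP su.
exact: (mono _ _ _ (leq_bigmax (Tuple su)) (fP (Tuple su))).
Qed.

(** [K] is a regular branching subgroup of the self-similar group [Gam]. In [br_der] the quantifier
    over [P] encodes membership in the commutator subgroup of [K]. *)
Record branching q (Gam K : set (tree_aut q)) (m0 m1 : nat) : Prop := Branching {
  br_Gam : subgrp Gam;
  br_sec : forall g i, Gam g -> Gam (sec g [:: i]);
  br_K : subgrp K;
  br_sub : K `<=` Gam;
  br_norm : forall k g, K k -> Gam g -> K (k ^ g);
  br_fin : fin_idx Gam K;
  br_emb : forall i k, K k -> K (emb [:: i] k);
  br_der : forall w k, size w = m0 -> K k -> forall P, subgrp P ->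
    (forall x y, K x -> K y -> P [~ x, y]) -> P (emb w k);
  br_move : forall w, size w = m1 -> exists2 k, K k & k w != w }.

Section Branch.
Variables (q m0 m1 : nat) (Gam K : set (tree_aut q)).
Hypothesis br : branching Gam K m0 m1.
Implicit Types (f g h k x y : tree_aut q) (u v w : seq 'I_q).
Implicit Types (H L : set (tree_aut q)).

Let sG := br_Gam br.
Let sK := br_K br.

Lemma br_sec_word g u : Gam g -> Gam (sec g u).
Proof.
elim: u g => [|i u IH] g Gg; first by rewrite sec_nil.
by rewrite -cat1s sec_cat; apply: IH; exact: (br_sec br).
Qed.

Lemma br_emb_word w k : K k -> K (emb w k).
Proof. by move=> Kk; elim: w => [|i w IH] //; exact: (br_emb br _ IH). Qed.

Lemma moves_take f n w : f (take n w) != take n w -> f w != w.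
Proof. by apply: contra => /eqP e; rewrite aut_take e. Qed.

(** The [y] found lies in the normal core of [L] in [K]. As [K] acts on finitely many cosets of [L],
    among enough elements of [K] that first move [w] at different depths two act alike; their
    quotient is in the core and moves [w]. *)
Lemma core_moves L : subgrp L -> fin_idx K L ->
  exists n, forall w, size w = n ->
    exists y, [/\ K y, forall k, K k -> L (k * y * k^-1) & y w != w].
Proof.
move=> sL fL; have [C [c [rep [cP Krep repP]]]] := fin_idx_reps (sg1 sK) fL.
(* [tau y] records the action of [y] by right multiplication on the cosets; it takes at most [N]
   values, hence the [N.+1] blocks of [m1] letters in [w]. *)
pose tau y : {ffun C -> C} := [ffun i => c (rep i * y)].
pose N := #|{ffun C -> C}|; exists (m1 * N.+1)%N => w sw.
have [k_ k_P] : {k_ : 'I_N.+1 -> tree_aut q & forall i : 'I_N.+1,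
   [/\ K (k_ i), k_ i (take (i.+1 * m1) w) != take (i.+1 * m1) w &
     forall j, (j <= i)%N -> k_ i (take (j * m1) w) = take (j * m1) w]}.
  apply: (@choice _ _ (fun (i : 'I_N.+1) z =>
    [/\ K z, z (take (i.+1 * m1) w) != take (i.+1 * m1) w &
     forall j, (j <= i)%N -> z (take (j * m1) w) = take (j * m1) w])) => i.
  have si : size (take (i * m1) w) = (i * m1)%N.
    by rewrite size_takel // sw mulnC leq_mul2l ltnW ?orbT.
  have sd : size (take m1 (drop (i * m1) w)) = m1.
    rewrite size_takel // size_drop sw mulnC -mulnBl leq_pmull //.
    by rewrite subn_gt0.
  have [k Kk km] := br_move br sd.
  exists (emb (take (i * m1) w) k); split; first exact: br_emb_word.
    rewrite mulSnr takeD emb_act; apply: contra km => /eqP e.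
    by apply/eqP; move/eqP: e; rewrite eqseq_cat // => /andP [_ /eqP].
  move=> j ji; rewrite emb_le // si size_take_min; apply: leq_trans (geq_minl _ _) _.
  by rewrite leq_mul2r ji orbT.
suff H (i j : 'I_N.+1) : (i < j)%N -> tau (k_ i) = tau (k_ j) ->
    exists y, [/\ K y, forall k, K k -> L (k * y * k^-1) & y w != w].
  have /injectivePn [i [j ne e]] : ~~ injectiveb (tau \o k_).
    by apply/negP => /injectiveP /leq_card; rewrite card_ord ltnn.
  have [ij|ji|ij] := ltngtP i j; [exact: (H i j)|exact: (H j i)|].
  by rewrite (val_inj ij) eqxx in ne.
move=> ij te; have [Ki mi _] := k_P i; have [Kj _ fj] := k_P j.
(* [k_ j] fixes the prefix of length [i.+1 * m1] that [k_ i] moves, so the quotient still moves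
   [w]. *)
exists (k_ i * (k_ j)^-1); split; first by apply: sgM => //; exact: sgV.
- move=> k Kk; set y := k_ i * _; set z := rep (c k).
  have Ly : L (z * y * z^-1).
    have -> : z * y * z^-1 = z * k_ i * (z * k_ j)^-1.
      by rewrite invgM !mulgA.
    apply: cP; [exact: (sgM sK (Krep _))|exact: (sgM sK (Krep _))|].
    by have := congr1 (fun F : {ffun C -> C} => F (c k)) te; rewrite !ffunE.
  have Lk := repP _ Kk; rewrite -/z in Lk.
  have -> : k * y * k^-1 = (k * z^-1) * (z * y * z^-1) * (k * z^-1)^-1.
    by rewrite invgM invgK !mulgA !mulgVK.
  by apply: sgM => //; [exact: sgM|exact: sgV].
- apply: (@moves_take _ (i.+1 * m1)); rewrite mulgE.
  apply: contra mi => /eqP e; apply/eqP.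
  by apply: (@aut_inj _ (k_ j)^-1); rewrite e -{2}(fj i.+1 ij) autK.
Qed.

(* Double commutators: if y moves w then [[emb w f, y], emb w g] is supported
   below w. *)
Lemma core_emb L : subgrp L -> fin_idx K L ->
  exists n, forall w k, size w = n -> K k -> L (emb w k).
Proof.
move=> sL fL; have [n nP] := core_moves sL fL; exists (n + m0)%N.
move=> w k sw Kk; have s1 : size (take n w) = n by rewrite size_takel // sw leq_addr.
have s2 : size (drop n w) = m0 by rewrite size_drop sw addKn.
rewrite -(cat_take_drop n w) emb_cat.
move: (take n w) (drop n w) s1 s2 => v w2 sv s2.
apply: (br_der br s2 Kk (P := fun y => L (emb v y))).
  split; first by rewrite emb1; exact: sg1.
    by move=> x y; rewrite embM; exact: sgM.
  by move=> x; rewrite embV; exact: sgV.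
move=> f g Kf Kg; have [y [Ky yL ym]] := nP v sv.
(* [[~ F, y]] is [F^-1] times a factor supported below [y v], which commutes with [F] and [G]; the
   inverse in [F] makes the double commutator come out as the copy of [[~ f, g]]. *)
pose F := emb v f^-1; pose G := emb v g.
have [F' eF'] : exists F', F' = F ^ y by exists (F ^ y).
have KF : K F by apply: br_emb_word; exact: sgV.
have KG : K G by apply: br_emb_word.
have syv : size v = size (y v) by rewrite size_aut.
have FF' : F ^ F' = F.
  apply/conjg_fixP/commgP; rewrite eF' embJ; apply: emb_commute_eqsize => //.
  by rewrite eq_sym.
have GF' : G ^ F' = G.
  apply/conjg_fixP/commgP; rewrite eF' embJ; apply: emb_commute_eqsize => //.
  by rewrite eq_sym.
have e : [~ [~ F, y], G] = emb v [~ f, g].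
  rewrite (commgEl F y) -eF'.
  have F'G : F' ^ G = F' by apply/conjg_fixP/commgP/commute_sym/commgP/conjg_fixP.
  rewrite commgEl conjMg F'G invgM invgK.
  have -> : F'^-1 * F * (F^-1 ^ G * F') = [~ F^-1, G] ^ F'.
    by rewrite commgEl invgK !conjgE !mulgA.
  by rewrite conjRg conjVg FF' GF' embR /F embV invgK.
rewrite -e.
(* Unlike [L], the set [M] of elements whose [K]-conjugates all lie in [L] absorbs commutators with
   [K]. *)
pose M := [set z | forall k, K k -> L (k * z * k^-1)].
have sM : subgrp M.
  split=> [k' _|a b Ma Mb k' Kk'|a Ma k' Kk'].
  - by rewrite mulg1 mulgV; exact: sg1.
  - have -> : k' * (a * b) * k'^-1 = (k' * a * k'^-1) * (k' * b * k'^-1).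
      by rewrite !mulgA mulgVK.
    by apply: (sgM sL); [exact: (Ma _ Kk')|exact: (Mb _ Kk')].
  - have -> : k' * a^-1 * k'^-1 = (k' * a * k'^-1)^-1.
      by rewrite !invgM invgK !mulgA.
    by apply: (sgV sL); exact: (Ma _ Kk').
have MJ a b : M a -> K b -> M (a ^ b).
  move=> Ma Kb k' Kk'; rewrite conjgE.
  have -> : k' * (b^-1 * (a * b)) * k'^-1 = (k' * b^-1) * a * (k' * b^-1)^-1.
    by rewrite invgM invgK !mulgA.
  by apply: (Ma (_ * _)); apply: (sgM sK) => //; exact: sgV.
have M1 : M [~ F, y].
  have My : M y := yL.
  by rewrite commgEr; apply: (sgM sM) => //; apply: MJ => //; exact: (sgV sM).
have M2 : M [~ [~ F, y], G].
  by rewrite commgEl; apply: (sgM sM); [exact: (sgV sM)|exact: MJ].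
by have := M2 1 (sg1 sK); rewrite mul1g invg1 mulg1.
Qed.

Definition good H u : Prop := forall k, K k -> H (emb u k).

Definition eventually_good H v : Prop :=
  exists n, forall u, size u = n -> good H (v ++ u).

(** The set [T] of the overview. It is closed under prefixes and, levels being finite, each of its
    vertices has descendants in it at every depth. *)
Definition bad_tree H : set (seq 'I_q) := [set v | ~ eventually_good H v].

Lemma good_cat H u v : good H u -> good H (u ++ v).
Proof. by move=> Hu k Kk; rewrite emb_cat; apply/Hu/br_emb_word. Qed.

Lemma eventually_goodW H v m m' : (m <= m')%N ->
  (forall u, size u = m -> good H (v ++ u)) ->
  forall u, size u = m' -> good H (v ++ u).
Proof.
move=> mm' gm u su; rewrite -(cat_take_drop m u) catA; apply: good_cat.
by apply: gm; rewrite size_takel ?su.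
Qed.

Lemma eventually_good_cat H u v :
  eventually_good H u -> eventually_good H (u ++ v).
Proof.
move=> [n nP]; exists n => w sw; rewrite -catA.
by apply: (eventually_goodW _ nP erefl); rewrite size_cat sw leq_addl.
Qed.

Lemma eventually_good_words H v n :
  (forall u, size u = n -> eventually_good H (v ++ u)) -> eventually_good H v.
Proof.
move=> ev.
have [|m mP] := words_uniform (n := n) (P := fun u m =>
    forall u', size u' = m -> good H ((v ++ u) ++ u')) _ ev.
  by move=> u m m' mm' gm; exact: eventually_goodW gm.
exists (n + m)%N => u su; rewrite -(cat_take_drop n u) catA; apply: mP.
  by rewrite size_takel // su leq_addr.
by rewrite size_drop su addKn.
Qed.

Lemma bad_tree_prefix H u v : bad_tree H (u ++ v) -> bad_tree H u.
Proof. by move=> b e; apply: b; exact: eventually_good_cat. Qed.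

Lemma bad_tree_good H u : bad_tree H u -> ~ good H u.
Proof. by move=> b gu; apply: b; exists 0%N => v _; exact: good_cat. Qed.

Lemma bad_tree_extend H v n : bad_tree H v ->
  exists2 u, size u = n & bad_tree H (v ++ u).
Proof.
move=> bv; apply: contrapT => ne; apply: bv.
by apply: (@eventually_good_words _ _ n) => u su; apply: contrapT => bu;
  apply: ne; exists u.
Qed.

(* The first coordinates of H in emb v K x emb w K. *)
Definition left_coord H v w : set (tree_aut q) :=
  [set y | K y /\ exists2 x, K x & H (emb v y * emb w x)].

Lemma left_coord_sub H v w : size v = size w -> v != w -> subgrp H ->
  subgrp (left_coord H v w).
Proof.
move=> svw nvw sH; have C x y := @emb_commute_eqsize _ v w x y svw nvw.
split.
- split; first exact: sg1.
  by exists 1; [exact: sg1|rewrite !emb1 mulg1; exact: sg1].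
- move=> y y' [Ky [x Kx Hx]] [Ky' [x' Kx' Hx']]; split; first exact: sgM.
  exists (x * x'); first exact: sgM.
  have := sgM sH Hx Hx'; congr H; rewrite !embM !mulgA; congr mulg.
  by rewrite -!mulgA C.
- move=> y [Ky [x Kx Hx]]; split; first exact: sgV.
  exists x^-1; first exact: sgV.
  by have := sgV sH Hx; congr H; rewrite invgM !embV -!embV C.
Qed.

(** The hypothesis gives copies of [K] at [v] only up to an unknown factor at [h v]. A second
    element [g] of [H], built from such a copy, moves a vertex [u] below [v] within the subtree of
    [v], so [u], [g u] and [h u] are distinct. An element of [H] supported below [u] and [h u] and
    one supported below [u] and [g u] have a commutator supported below [u] alone. *)
Theorem eventually_good_moved H : subgrp H ->
  (forall v h, H h -> h v != v -> fin_idx K (left_coord H v (h v))) ->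
  forall v h, H h -> h v != v -> eventually_good H v.
Proof.
move=> sH fH v h Hh hv.
have core v' h' : H h' -> h' v' != v' ->
    exists n, forall w k, size w = n -> K k -> left_coord H v' (h' v') (emb w k).
  move=> Hh' hv'; apply: core_emb; last exact: fH.
  by apply: left_coord_sub => //; rewrite ?size_aut // eq_sym.
have [n nP] := core v h Hh hv.
(* Depth [n] makes copies of [K] available as first coordinates; [m1] more letters let one of their
   elements move the end of [w]. *)
apply: (@eventually_good_words _ _ (n + m1)) => w sw.
have sd : size (drop n w) = m1 by rewrite size_drop sw addKn.
have [k Kk km] := br_move br sd.
have [|_ [x Kx]] := nP (take n w) k _ Kk; first by rewrite size_takel // sw leq_addr.
set g := _ * _ => Hg.
set u := v ++ w; set y := emb (take n w) k in g Hg.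
have yw : y w != w.
  rewrite -(cat_take_drop n w) /y emb_act; apply: contra km => /eqP e.
  by apply/eqP; move/eqP: e; rewrite eqseq_cat // => /andP [_ /eqP].
have gu : g u = v ++ y w.
  rewrite /g mulgE emb_act emb_fix //; apply/negP.
  rewrite prefixE size_aut take_size_cat // => /eqP e.
  by rewrite -e eqxx in hv.
have gnu : g u != u by rewrite gu eqseq_cat // eqxx.
have hu : h u = h v ++ sec h v w by rewrite aut_cat.
have hnu : h u != u by rewrite hu eqseq_cat ?size_aut // negb_and hv.
have hgu : h u != g u by rewrite gu hu eqseq_cat ?size_aut // negb_and hv.
have [n1 n1P] := core u h Hh hnu; have [n2 n2P] := core u g Hg gnu.
(* [n1 + n2] letters reach the copies of [K] for both pairs of vertices; after [m0] more, copies of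
   [K] consist of products of commutators. *)
exists (n1 + n2 + m0)%N => u' su'.
have s1 : size (drop (n1 + n2) u') = m0 by rewrite size_drop su' addKn.
have s2 : size (take (n1 + n2) u') = (n1 + n2)%N by rewrite size_takel // su' leq_addr.
rewrite -(cat_take_drop (n1 + n2) u').
move: (take _ _) (drop _ _) s1 s2 => w1 w2 s2 s1 k0 Kk0.
rewrite catA emb_cat; apply: (br_der br s2 Kk0 (P := fun y => H (emb (u ++ w1) y))).
  split; first by rewrite emb1; exact: sg1.
    by move=> a b; rewrite embM; exact: sgM.
  by move=> a; rewrite embV; exact: sgV.
move=> a b Ka Kb.
have [_ [x1 Kx1 H1]] : left_coord H u (h u) (emb w1 a).
  rewrite -(cat_take_drop n1 w1) emb_cat; apply: n1P; last exact: br_emb_word.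
  by rewrite size_takel // s1 leq_addr.
have [_ [x2 Kx2 H2]] : left_coord H u (g u) (emb w1 b).
  rewrite -(cat_take_drop n2 w1) emb_cat; apply: n2P; last exact: br_emb_word.
  by rewrite size_takel // s1 leq_addl.
have := sgR sH H1 H2; congr H; rewrite emb_cat !embR -!emb_cat !(emb_cat u).
set A := emb u _; set B := emb u _.
set X := emb (h u) x1; set Y := emb (g u) x2.
have AX : commute A X by apply: emb_commute_eqsize; rewrite ?size_aut // eq_sym.
have AY : commute A Y by apply: emb_commute_eqsize; rewrite ?size_aut // eq_sym.
have BX : commute B X by apply: emb_commute_eqsize; rewrite ?size_aut // eq_sym.
have BY : commute B Y by apply: emb_commute_eqsize; rewrite ?size_aut // eq_sym.
have XY : commute X Y by apply: emb_commute_eqsize; rewrite ?size_aut // eq_sym.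
(* The far factors [X] and [Y] commute with each other and with [A] and [B], so the conjugation only
   affects [A]. *)
have cX : (A * X) ^ (B * Y) = A ^ B * X.
  rewrite conjMg !conjgM.
  have -> : X ^ B = X by apply/conjg_fixP/commgP/commute_sym.
  have -> : X ^ Y = X by apply/conjg_fixP/commgP.
  congr mulg; apply/conjg_fixP/commgP; apply: commute_sym; rewrite conjgE.
  by apply: commuteM; [exact/commuteV/commute_sym|apply: commuteM; exact: commute_sym].
have cAB : A ^ B * X = X * A ^ B.
  apply: commute_sym; rewrite conjgE.
  by apply: commuteM; [apply: commuteV|apply: commuteM]; exact: commute_sym.
have cA : X^-1 * A^-1 = A^-1 * X^-1.
  by apply: commute_sym; apply/commuteV/commute_sym/commuteV/commute_sym.
by rewrite !commgEl cX invgM cA cAB -[LHS]mulgA mulKg.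
Qed.

(** The group [N_n] of the overview, described by sections; [prod_sec_sub] recovers the description
    by products of copies of [K]. *)
Definition cong_sub n : set (tree_aut q) :=
  [set g | Gam g /\ forall u, size u = n -> g u = u /\ K (sec g u)].

Definition trivial_on g u : Prop := g u = u /\ sec g u = 1.

(** This is [A_n(H)] of the overview, and [cong_approx n H] is [A_n(H) N_n]. *)
Definition trunc n H : set (tree_aut q) :=
  [set h | H h /\ forall u, size u = n -> good H u \/ trivial_on h u].

Definition cong_approx n H : set (tree_aut q) :=
  [set g | exists2 h, trunc n H h & cong_sub n (h^-1 * g)].

Lemma trivial_on_cat g u v : trivial_on g u -> trivial_on g (u ++ v).
Proof.
by move=> [gu su]; split; rewrite ?aut_cat ?sec_cat su ?gu // sec1.
Qed.

Lemma trivial_onM g h u : trivial_on g u -> trivial_on h u -> trivial_on (g * h) u.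
Proof. by move=> [gu sg] [hu sh]; split; rewrite ?mulgE ?secM gu // sg sh mulg1. Qed.

Lemma trivial_onV g u : trivial_on g u -> trivial_on g^-1 u.
Proof.
move=> [gu su]; have e : g^-1 u = u by rewrite -{1}gu autK.
by split => //; rewrite -gu secV su invg1.
Qed.

Lemma cong_sub_sub n : subgrp (cong_sub n).
Proof.
split.
- split; first exact: sg1.
  by move=> u _; split => //; rewrite sec1; exact: sg1.
- move=> x y [Gx xP] [Gy yP]; split; first exact: sgM.
  move=> u su; have [xu Kx] := xP u su; have [yu Ky] := yP u su.
  by rewrite mulgE secM xu yu; split => //; exact: sgM.
- move=> x [Gx xP]; split; first exact: sgV.
  move=> u su; have [xu Kx] := xP u su.
  have e : x^-1 u = u by rewrite -{1}xu autK.
  by split => //; rewrite -[in sec _ _]xu secV; exact: sgV.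
Qed.

Lemma cong_subJ n g x : Gam g -> cong_sub n x -> cong_sub n (x ^ g).
Proof.
move=> Gg [Gx xP]; split; first exact: sgJ.
move=> u su; have [|xu Kx] := xP (g^-1 u); first by rewrite size_aut.
rewrite conjgE !mulgE xu autKV; split => //.
rewrite !secM xu -[X in sec g^-1 X](autKV g) secV -conjgE.
by apply: (br_norm br) => //; exact: br_sec_word.
Qed.

(** The finite data are the permutation of level [n] and the class modulo [K] of each section at
    that level. *)
Lemma fin_idx_cong n : fin_idx Gam (cong_sub n).
Proof.
have [C [c cP]] := br_fin br.
have ts g (t : n.-tuple 'I_q) : size (g t) == n.
  by rewrite size_aut size_tuple.
exists [the finType of {ffun n.-tuple 'I_q -> n.-tuple 'I_q * C}].
exists (fun g => [ffun t => (Tuple (ts g t), c (sec g t))]).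
move=> x y Gx Gy /ffunP e; split; first by apply: sgM => //; exact: sgV.
move=> u /eqP su; have := e (Tuple su); rewrite !ffunE => -[/= xy cxy].
split; first by rewrite xy autK.
by rewrite secM xy secV; apply: cP => //; exact: br_sec_word.
Qed.

Lemma trunc_sub n H : subgrp H -> subgrp (trunc n H).
Proof.
move=> sH; split.
- by split; [exact: sg1|move=> u _; right; split => //; rewrite sec1].
- move=> x y [Hx xP] [Hy yP]; split; first exact: sgM.
  move=> u su; have [gu|tx] := xP u su; first by left.
  by have [gu|ty] := yP u su; [left|right; exact: trivial_onM].
- move=> x [Hx xP]; split; first exact: sgV.
  by move=> u su; have [gu|tx] := xP u su; [left|right; exact: trivial_onV].
Qed.

Lemma cong_sub_approx n H : subgrp H -> cong_sub n `<=` cong_approx n H.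
Proof.
by move=> sH g Ng; exists 1; [exact: sg1 (trunc_sub _ sH)|rewrite invg1 mul1g].
Qed.

Lemma cong_approx_sub n H : subgrp H -> H `<=` Gam -> subgrp (cong_approx n H).
Proof.
move=> sH HG; have sA := trunc_sub n sH; have sN := cong_sub_sub n.
have AG h : trunc n H h -> Gam h by case=> /HG.
split.
- by exists 1; [exact: sg1|rewrite invg1 mulg1; exact: sg1].
- move=> x y [h Ah Nx] [h' Ah' Ny]; exists (h * h'); first exact: sgM.
  have -> : (h * h')^-1 * (x * y) = (h^-1 * x) ^ h' * (h'^-1 * y).
    by rewrite invgM conjgE !mulgA mulgK.
  by apply: sgM => //; apply: cong_subJ => //; exact: AG.
- move=> x [h Ah Nx]; exists h^-1; first exact: sgV.
  have -> : h^-1^-1 * x^-1 = ((h^-1 * x)^-1) ^ h^-1.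
    by rewrite invgM !invgK conjgE invgK mulgK.
  apply: cong_subJ; first by apply: AG; exact: sgV.
  exact: (sgV sN).
Qed.

(** Each of the finitely many vertices of level [n] is bad or has only good descendants from some
    depth on; a common depth exists. *)
Lemma bad_tail H n : exists m, forall u, (m <= size u)%N -> ~ good H u ->
  bad_tree H (take n u).
Proof.
have [||m mP] := words_uniform (I := 'I_q) (n := n) (P := fun v m => bad_tree H v \/
    forall u, size u = m -> good H (v ++ u)).
- by move=> u m m' mm' [|gm]; [left|right; exact: eventually_goodW gm].
- move=> u su; have [[m mP]|b] := pselect (eventually_good H u).
    by exists m; right.
  by exists 0%N; left.
exists (n + m)%N => u su gu.
have [|//|mg] := mP (take n u).
  by rewrite size_takel // (leq_trans _ su) // leq_addr.
case: gu; rewrite -(cat_take_drop n u); apply: (eventually_goodW _ mg erefl).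
by rewrite size_drop leq_subRL ?(leq_trans _ su) // leq_addr.
Qed.

(** If [g] moves a bad vertex, then neither side contains it. Otherwise [g] is trivial below the bad
    vertices of some level, hence at every vertex of a deep enough level that is not good. *)
Theorem cong_approx_cvg H : subgrp H -> H `<=` Gam ->
  (forall h u, H h -> bad_tree H u -> h u = u) ->
  (forall g, Gam g -> (forall u, bad_tree H u -> g u = u) ->
     exists n, forall u, size u = n -> bad_tree H u -> sec g u = 1) ->
  forall g, Gam g -> exists n0, forall n, (n0 <= n)%N -> cong_approx n H g <-> H g.
Proof.
move=> sH HG fixH germ g Gg.
have [gfix|] := pselect (forall u, bad_tree H u -> g u = u); last first.
  move=> /existsNP [u /not_implyP [bu gu]].
  have nHg : ~ H g by move=> Hg; apply: gu; exact: fixH.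
  exists (size u) => n un; split => // -[h [_ hP] [_ fP]].
  (* A bad descendant at level [n] is not good, so [h] is trivial there, and the factor in
     [cong_sub] fixes it too. *)
  have [u' su' bu'] := bad_tree_extend (n - size u) bu.
  have sn : size (u ++ u') = n by rewrite size_cat su' subnKC.
  have [/(bad_tree_good bu') []|[hu _]] := hP _ sn.
  have [fu _] := fP _ sn; case: gu.
  have : g (u ++ u') = u ++ u'.
    by rewrite -(mulVKg h g) mulgE hu fu.
  by move=> /(congr1 (take (size u))); rewrite -aut_take take_size_cat.
have [n1 n1P] := germ g Gg gfix; have [n2 n2P] := bad_tail H n1.
exists (n1 + n2)%N => n nn.
have gtriv u : size u = n -> ~ good H u -> trivial_on g u.
  move=> su gu; have b : bad_tree H (take n1 u).
    by apply: n2P => //; rewrite su (leq_trans _ nn) // leq_addl.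
  rewrite -(cat_take_drop n1 u); apply: trivial_on_cat; split; first exact: gfix.
  by apply: n1P => //; rewrite size_takel // su (leq_trans _ nn) // leq_addr.
split=> [[h [Hh hP] [_ fP]]|Hg].
  (* At a good vertex the copy of the section of [h^-1 * g] lies in [H]; at the others [h] and [g]
     are both trivial. *)
  rewrite -(mulVKg h g); apply: sgM => //.
  apply: (prod_sec_sub (n := n)) => // u su; have [fu Kf] := fP u su => //.
  have [gu|gu] := pselect (good H u); first exact: gu.
  have [//|th] := hP u su; have tg := gtriv u su gu.
  have [_ ->] := trivial_onM (trivial_onV th) tg.
  by rewrite emb1; exact: sg1.
exists g; last by rewrite mulVg; exact: sg1 (cong_sub_sub n).
split => // u su; have [gu|gu] := pselect (good H u); [by left|right; exact: gtriv].
Qed.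

Definition conjS g H : set (tree_aut q) := [set x | H (x ^ g^-1)].

Lemma conjSV g H : conjS g^-1 (conjS g H) = H.
Proof. by apply/funext => x; rewrite /conjS /mkset invgK conjgK. Qed.

Lemma good_conjS g H u : Gam g -> good (conjS g H) (g u) = good H u.
Proof.
suff imp g' H' u' : Gam g' -> good H' u' -> good (conjS g' H') (g' u').
  move=> Gg; apply/propext; split; last exact: imp.
  by move=> /(imp _ _ _ (sgV sG Gg)); rewrite conjSV autK.
move=> Gg gu k Kk; rewrite /conjS /mkset embJ autK; apply: gu.
by apply: (br_norm br) => //; apply: br_sec_word; exact: sgV.
Qed.

Lemma bad_tree_conjS g H u : Gam g -> bad_tree (conjS g H) (g u) = bad_tree H u.
Proof.
move=> Gg; congr not; apply/propext; split=> -[n nP]; exists n => v sv.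
  have := nP (sec g u v); rewrite size_aut => /(_ sv).
  by rewrite -aut_cat good_conjS.
rewrite -(autKV (sec g u) v) -aut_cat good_conjS //; apply: nP.
by rewrite size_aut.
Qed.

(** Conjugation by a copy at [w] only changes the second coordinate, which is quantified away. *)
Lemma left_coord_conjS H v w y x0 : size v = size w -> v != w ->
  K x0 -> left_coord (conjS (emb w x0) H) v w y = left_coord H v w y.
Proof.
move=> svw nvw.
suff imp H' x' : K x' -> left_coord H' v w y -> left_coord (conjS (emb w x') H') v w y.
  move=> Kx0; apply/propext; split; last exact: imp.
  move=> /(imp _ _ (sgV sK Kx0)); rewrite embV conjSV; exact.
move=> Kx' [Ky [x Kx Hx]]; split => //; exists (x ^ x'); first exact: sgJ.
rewrite /conjS /mkset conjMg; move: Hx; congr H'; congr mulg.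
  apply/esym/conjg_fixP/commgP/commuteV; exact: emb_commute_eqsize.
by rewrite -embV embJ emb_self sec_emb conjgK.
Qed.

Lemma trunc_conjS n g H x : Gam g -> trunc n H x -> trunc n (conjS g H) (x ^ g).
Proof.
move=> Gg [Hx xP]; split; first by rewrite /conjS /mkset conjgK.
move=> u su; rewrite -(autKV g u) good_conjS //.
have [|gu|[xu sx]] := xP (g^-1 u); [by rewrite size_aut|by left|right].
split; first by rewrite conjgE 2!mulgE autK xu.
by rewrite conjgE !secM secV autK sx xu mul1g mulVg.
Qed.

Lemma cong_approx_conjS n g H x : Gam g -> cong_approx n (conjS g H) x =
  cong_approx n H (x ^ g^-1).
Proof.
suff imp g' H' x' : Gam g' -> cong_approx n H' x' -> cong_approx n (conjS g' H') (x' ^ g').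
  move=> Gg; apply/propext; split.
    by move=> /(imp _ _ _ (sgV sG Gg)); rewrite conjSV.
  by move=> /(imp _ _ _ Gg); rewrite conjgKV.
move=> Gg [h Ah Nx]; exists (h ^ g'); first exact: trunc_conjS.
by rewrite -conjVg -conjMg; exact: cong_subJ.
Qed.

End Branch.

(** * The space of subgroups *)

Section Measurability.
Context d (T : measurableType d).

Lemma measurable_Prop (P : Prop) : measurable [set _ : T | P].
Proof.
have [p|np] := pselect P.
  by rewrite (_ : [set _ | _] = setT) //; apply/seteqP; split.
by rewrite (_ : [set _ | _] = set0) //; apply/seteqP; split.
Qed.

Lemma measurable_not (P : T -> Prop) : measurable [set x | P x] ->
  measurable [set x | ~ P x].
Proof. exact: measurableC. Qed.

Lemma measurable_andP (P : Prop) (Q : T -> Prop) :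
  (P -> measurable [set x | Q x]) -> measurable [set x | P /\ Q x].
Proof.
move=> mQ; have [p|np] := pselect P.
  have -> : [set x | P /\ Q x] = [set x | Q x].
    by apply/seteqP; split => x /= => [[]|].
  exact: mQ.
have -> : [set x | P /\ Q x] = set0 by apply/seteqP; split => x // -[].
exact: measurable0.
Qed.

Lemma measurable_imp (P : Prop) (Q : T -> Prop) :
  (P -> measurable [set x | Q x]) -> measurable [set x | P -> Q x].
Proof.
move=> mQ; have [p|np] := pselect P.
  have -> : [set x | P -> Q x] = [set x | Q x] by apply/seteqP; split => x /=; auto.
  exact: mQ.
have -> : [set x | P -> Q x] = setT by apply/seteqP; split => // x _ /np.
exact: measurableT.
Qed.

Lemma measurable_exists (I : countType) (P : I -> T -> Prop) :
  (forall i, measurable [set x | P i x]) -> measurable [set x | exists i, P i x].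
Proof.
move=> mP; have -> : [set x | exists i, P i x] = \bigcup_i [set x | P i x].
  by apply/seteqP; split => x /= [i]; exists i.
exact: countable_bigcupT_measurable.
Qed.

Lemma measurable_forall (I : countType) (P : I -> T -> Prop) :
  (forall i, measurable [set x | P i x]) -> measurable [set x | forall i, P i x].
Proof.
move=> mP; have -> : [set x | forall i, P i x] = ~` [set x | exists i, ~ P i x].
  apply/seteqP; split => x /= Px; first by case=> i; exact.
  by move=> i; apply: contrapT => nPx; apply: Px; exists i.
by apply/measurableC/measurable_exists => i; exact: measurable_not.
Qed.

Lemma ae_forall_countType (R : realType) (mu : probability T R)
    (I : countType) (P : I -> T -> Prop) :
  (forall i, {ae mu, forall x, P i x}) -> {ae mu, forall x, forall i, P i x}.
Proof.
move=> aeP.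
have : {ae mu, forall x, forall n, oapp (fun i => P i x) True (@unpickle I n)}.
  apply: ae_foralln => n; case: (unpickle n) => [i|] /=; first exact: aeP.
  exact: aeW.
by apply: filterS => x Px i; have := Px (pickle i); rewrite pickleK.
Qed.

Lemma ae_imply (R : realType) (mu : probability T R) (P Q : T -> Prop) :
  (forall x, P x -> Q x) -> {ae mu, forall x, P x} -> {ae mu, forall x, Q x}.
Proof. by move=> PQ; apply: filterS. Qed.

Lemma ae_imply2 (R : realType) (mu : probability T R) (P1 P2 Q : T -> Prop) :
  (forall x, P1 x -> P2 x -> Q x) -> {ae mu, forall x, P1 x} ->
  {ae mu, forall x, P2 x} -> {ae mu, forall x, Q x}.
Proof. by move=> PQ; apply: filterS2. Qed.

End Measurability.

Section SubgroupSpace.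
Variable G : groupType.
Implicit Types (H : subgroup_space G) (g : G).

Lemma mem_sub_continuous g : continuous (fun H => val H g : bool).
Proof.
move=> H; apply: (@continuous_comp _ _ _ (set_val : subgroup_space G -> _) (fun K => K g)).
  exact: (@initial_continuous (subgroup_space G)).
exact: (@proj_continuous G (fun=> bool) g).
Qed.

Lemma open_measurableSub (A : set (BorelSub G)) :
  open (A : set (subgroup_space G)) -> measurable A.
Proof. by move=> oA; exact: sub_sigma_algebra. Qed.

Lemma measurable_mem g : measurable [set H : BorelSub G | g \in mem_sub H].
Proof.
apply: open_measurableSub; rewrite -[X in open X]/((fun H => val H g : bool)
  @^-1` [set b | b]).
apply: (@open_comp _ _ (fun H => val H g : bool)); last exact: discrete_open.
by move=> H _; exact: mem_sub_continuous.
Qed.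

Lemma continuous_measurableSub (R : realType) (f : subgroup_space G -> R) :
  continuous f -> measurable_fun setT (f : BorelSub G -> R).
Proof.
move=> cf; apply: (measurability _ (RGenOpens.measurableE R)).
move=> _ [_ [a [b ->] <-]]; rewrite setTI; apply: open_measurableSub.
by apply: open_comp; [move=> x _; exact: cf|exact: interval_open].
Qed.

Lemma subgroup_closed : closed (subgroup_set G).
Proof.
have -> : subgroup_set G = [set H : prod_topology (fun _ : G => bool) | H 1] `&`
    \bigcap_(xy in [set: G * G])
      [set H : prod_topology (fun _ : G => bool) | ~~ H xy.1 || ~~ H xy.2 || H
        (xy.1 * xy.2^-1)].
  apply/seteqP; split => H /=.
    move=> [H1 HF]; split => // -[x y] _ /=.
    by have := HF x y; rewrite !unfold_in; case: (H x) => //; case: (H y) => //= ->.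
  move=> [H1 HF]; split => // x y; rewrite !unfold_in => Hx Hy.
  by have := HF (x, y) I; rewrite /= Hx Hy.
have cl (B : set bool) g : closed [set H : prod_topology (fun _ : G => bool) | B (H g)].
  have cp : continuous (fun H : prod_topology (fun _ : G => bool) => H g).
    exact: (@proj_continuous G (fun=> bool) g).
  by have := preimage_closed (D := B) (in1W cp) (@discrete_closed bool B).
apply: closedI; first exact: (cl [set b | b]).
apply: closed_bigI => -[x y] _ /=.
pose Y := prod_topology (fun _ : G => bool).
rewrite (_ : [set H | _] = ([set H : Y | ~~ H x] `|` [set H : Y | ~~ H y]) `|`
    [set H : Y | H (x * y^-1)]).
  apply: closedU; last exact: (cl [set b | b]).
  by apply: closedU; exact: (cl [set b | ~~ b]).
apply/seteqP; split => H /=; last by move=> [[->|->]|->]; rewrite ?orbT.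
by move=> /orP [/orP [nx|ny]|xy]; [left; left|left; right|right].
Qed.

Lemma compact_bool_fun : compact [set: prod_topology (fun _ : G => bool)].
Proof.
have := @tychonoff G (fun=> bool) (fun=> setT) (fun=> bool_compact).
by congr compact; apply/seteqP; split.
Qed.

(** Serves to bound continuous functions for dominated convergence. A filter is pushed forward to
    the closed set of subgroups in the product space, where Tychonoff applies. *)
Lemma compact_Sub : compact [set: subgroup_space G].
Proof.
have cS : compact (subgroup_set G).
  apply: (subclosed_compact subgroup_closed compact_bool_fun); exact: subsetT.
move=> F FF _.
have FF' : ProperFilter ((set_val : subgroup_space G -> _) @ F) by exact:
  fmap_proper_filter.
have [|H [SH clH]] := cS _ FF'.
  exact: (@filterE _ F _ _ (fun H : subgroup_space G => set_valP H)).
exists (exist _ H (mem_set SH)); split => // A B FA [_ [[U oU <-] UH] UB].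
have [||_ [[K AK <-] UK]] := clH (set_val @` A) U.
- by apply: (@filterS _ F _ A _ _ FA) => K AK; exists K.
- exact: open_nbhs_nbhs.
by exists K; split => //; exact: UB.
Qed.

Lemma continuous_bounded_Sub (R : realType) (f : subgroup_space G -> R) :
  continuous f -> exists M : R, forall H, (`|f H| <= M)%R.
Proof.
move=> cf.
have /compact_bounded [M [_ MP]] : compact (f @` setT).
  by apply: continuous_compact compact_Sub; apply: continuous_subspaceT.
exists (M + 1)%R => H; apply: (MP (M + 1)%R); last by exists H.
by rewrite ltrDl.
Qed.

Lemma cvg_Sub (H_ : nat -> subgroup_space G) H :
  (forall g, exists n0, forall n, (n0 <= n)%N -> val (H_ n) g = val H g) ->
  H_ @ \oo --> H.
Proof.
move=> ev A [_ [[U oU <-] UH] UA].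
suff : (fun n => val (H_ n)) @ \oo --> (val H : prod_topology (fun=> bool)).
  move=> /(_ U); rewrite nbhs_filterE; move=> /(_ (open_nbhs_nbhs (conj oU UH))) FU.
  apply: (@filterS nat \oo _ _ _ _ FU) => n; exact: (UA (H_ n)).
apply/cvg_sup => g V [_ [[W oW <-] WH] WV].
have [n0 n0P] := ev g; exists n0 => // n /= n0n; apply: WV.
by rewrite /= n0P.
Qed.

End SubgroupSpace.

(** * Double commutators in invariant random subgroups *)

Section Carrier.
Variables (q : nat) (S : set (tree_aut q)).
Local Notation G := (gen_group S).
Implicit Types (H : subgroup_space G) (g x : tree_aut q).

Definition gen_set : set (tree_aut q) := [set g : tree_aut q | g \in Defs.generated S].

Lemma gen_set_val (c : G) : gen_set (val c).
Proof. exact: valP. Qed.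

Lemma gen_set_sub : subgrp gen_set.
Proof.
have [H1 HF] := generated_group_closed S.
have HV := group_closedV (conj H1 HF).
have HM := group_closedM (conj H1 HF).
by split; [exact: H1|exact: HM|exact: HV].
Qed.

Lemma gen_set_min (P : set (tree_aut q)) : subgrp P -> S `<=` P -> gen_set `<=` P.
Proof.
move=> sP SP g /asboolP gS.
suff : g \in ((fun x => `[< P x >]) : {pred tree_aut q}) by move=> /asboolP.
apply: gS => [|s Ss]; last by rewrite unfold_in; apply/asboolP; exact: SP.
split; first by rewrite unfold_in; apply/asboolP; exact: sg1 sP.
move=> x y; rewrite !unfold_in => /asboolP Px /asboolP Py.
by apply/asboolP; apply: (sgM sP) => //; exact: (sgV sP).
Qed.

Lemma gen_set_gen : S `<=` gen_set.
Proof. by move=> s Ss; apply/asboolP => K _; exact. Qed.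

Lemma gen_set_lift g : gen_set g -> exists c : G, val c = g.
Proof. by move=> Gg; exists (exist _ g Gg). Qed.

(* The subgroup of tree automorphisms that a point of Sub(G) stands for. *)
Definition carrier H : set (tree_aut q) :=
  [set g | exists2 c : G, val c = g & c \in mem_sub H].

Lemma carrier_val H (c : G) : carrier H (val c) = (c \in mem_sub H) :> Prop.
Proof.
apply/propext; split; last by exists c.
by case=> c' /val_inj ->.
Qed.

Lemma carrier_gen H : carrier H `<=` gen_set.
Proof. by move=> _ [c <- _]; exact: gen_set_val. Qed.

Lemma carrier_sub H : subgrp (carrier H).
Proof.
have /= HG : group_closed (mem_sub H) := set_valP H.
have [H1 _] := HG; have HV := group_closedV HG; have HM := group_closedM HG.
split.
- by exists 1.
- by move=> _ _ [c <- Hc] [c' <- Hc']; exists (c * c') => //; exact: HM.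
- by move=> _ [c <- Hc]; exists c^-1 => //; exact: HV.
Qed.

Lemma carrier_conj (c : G) H : carrier (conj_sub c H) = conjS (val c) (carrier H).
Proof.
apply/funext => x; apply/propext; split.
  by move=> [c' <- Hc']; exists (c' ^ c^-1).
move=> [c' e Hc']; exists (c' ^ c); first by rewrite -(conjgKV (val c) x) -e.
by rewrite -[_ \in _]/((c' ^ c) ^ c^-1 \in mem_sub H) conjgK.
Qed.

Hypothesis Gcount : exists e : nat -> G, forall c, exists n, e n = c.
Local Notation B := (BorelSub G).

Lemma measurable_carrier g : measurable [set H : B | carrier H g].
Proof.
have [/gen_set_lift [c <-]|ng] := pselect (gen_set g).
  have -> : [set H : B | carrier H (val c)] = [set H : B | c \in mem_sub H].
    by apply/funext => H; exact: carrier_val.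
  exact: measurable_mem.
have -> : [set H : B | carrier H g] = set0; last exact: measurable0.
by apply/seteqP; split => H // /carrier_gen.
Qed.

Lemma measurable_exists_gen (Q : set (tree_aut q)) (P : tree_aut q -> B -> Prop) :
  Q `<=` gen_set -> (forall x, Q x -> measurable [set H | P x H]) ->
  measurable [set H | exists2 x, Q x & P x H].
Proof.
move=> QG mP; have [e eP] := Gcount.
have -> : [set H | exists2 x, Q x & P x H] =
    [set H | exists n, Q (val (e n)) /\ P (val (e n)) H].
  apply/seteqP; split => H /=; last by case=> n [Qn Pn]; exists (val (e n)); auto.
  move=> [x Qx Px]; have [c ec] := gen_set_lift (QG _ Qx).
  by have [n en] := eP c; exists n; rewrite en ec.
by apply: measurable_exists => n; apply: measurable_andP => Qn; exact: (mP _ Qn).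
Qed.

Lemma measurable_forall_gen (Q : set (tree_aut q)) (P : tree_aut q -> B -> Prop) :
  Q `<=` gen_set -> (forall x, Q x -> measurable [set H | P x H]) ->
  measurable [set H | forall x, Q x -> P x H].
Proof.
move=> QG mP.
have -> : [set H | forall x, Q x -> P x H] = ~` [set H | exists2 x, Q x & ~ P x H].
  apply/seteqP; split => H /= PH; first by case=> x Qx; apply; exact: PH.
  by move=> x Qx; apply: contrapT => nP; apply: PH; exists x.
apply: measurableC; apply: measurable_exists_gen => // x Qx.
by apply: measurable_not; exact: (mP _ Qx).
Qed.

Lemma ae_forall_gen (R : realType) (mu : probability B R)
    (P : tree_aut q -> B -> Prop) :
  (forall x, gen_set x -> {ae mu, forall H, P x H}) ->
  {ae mu, forall H, forall x, gen_set x -> P x H}.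
Proof.
move=> aeP; have [e eP] := Gcount.
have : {ae mu, forall H, forall n, P (val (e n)) H}.
  by apply: ae_forall_countType => n; apply: aeP; exact: gen_set_val.
apply: ae_imply => H PH x Gx; have [c ec] := gen_set_lift Gx.
by have [n en] := eP c; have := PH n; rewrite en ec.
Qed.

End Carrier.

Section IRS.
Variables (R : realType) (q m0 m1 : nat) (S K : set (tree_aut q)).
Local Notation Gam := (gen_set S).
Local Notation G := (gen_group S).
Local Notation B := (BorelSub G).
Hypothesis Gcount : exists e : nat -> G, forall c, exists n, e n = c.
Hypothesis br : branching Gam K m0 m1.
Variable mu : probability B R.
Hypothesis irs : is_IRS mu.
Implicit Types (H : B) (g h x y : tree_aut q) (u v w : seq 'I_q).

Let sG := br_Gam br.
Let sK := br_K br.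
Let KG := br_sub br.

Lemma irs_conj g (A : set B) : Gam g -> measurable A ->
  exists2 c : G, val c = g & mu (conj_sub c @^-1` A) = mu A.
Proof. by move=> /gen_set_lift [c <-] mA; exists c => //; exact: irs. Qed.

Lemma measurable_good u : measurable [set H : B | good K (carrier H) u].
Proof. by apply: measurable_forall_gen => // k _; exact: measurable_carrier. Qed.

Lemma measurable_bad_tree u : measurable [set H : B | bad_tree K (carrier H) u].
Proof.
apply: measurable_not; apply: measurable_exists => n; apply: measurable_forall => v.
by apply: measurable_imp => _; exact: measurable_good.
Qed.

Lemma measurable_coord v w y : measurable [set H : B | left_coord K (carrier H) v w y].
Proof.
apply: measurable_andP => Ky.
by apply: measurable_exists_gen => // x _; exact: measurable_carrier.
Qed.

(* Conjugating by K on the second coordinate does not change left_coord, while the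
   events "h^c in H", for c running over that conjugating group, are disjoint
   when restricted to representatives of distinct cosets of left_coord. *)
Lemma ae_fin_idx_left_coord v h : Gam h -> h v != v ->
  {ae mu, forall H, carrier H h -> fin_idx K (left_coord K (carrier H) v (h v))}.
Proof.
move=> Gh hv; have [e eP] := Gcount.
(* An enumeration of [K], possibly with repetitions; indices pointing outside [K] are sent to 1. *)
have [r [Kr rP]] : exists r : nat -> tree_aut q,
    (forall n, K (r n)) /\ forall k, K k -> exists n, r n = k.
  exists (fun n => if `[< K (val (e n)) >] then val (e n) else 1); split.
    by move=> n; case: asboolP => // _; exact: sg1 sK.
  move=> k Kk; have [c ec] := gen_set_lift (KG Kk); have [n en] := eP c.
  by exists n; rewrite en ec; case: asboolP.
pose E := [set H : B | carrier H h].
(* [I n] says that [r n] is the first enumerated member of its coset, so infinitely many of these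
   events occur exactly when the index is infinite. *)
pose I n := [set H : B | forall j : 'I_n, ~ left_coord K (carrier H) v (h v) (r
  n * (r j)^-1)].
have mE : measurable E by exact: measurable_carrier.
have mI n : measurable (I n).
  by apply: measurable_forall => j; apply: measurable_not; exact: measurable_coord.
(* [c n] acts below [h v], where conjugation is invisible to [left_coord]; it is also the conjugate
   of [emb v (r n)] by [h]. *)
pose c n := emb (h v) (r n ^ sec h v).
have Kc n : K (r n ^ sec h v) by apply: (br_norm br) => //; exact: (br_sec_word br).
have Gc n : Gam (c n) by apply: KG; exact: (br_emb_word br).
have cE n : c n = emb v (r n) ^ h by rewrite embJ.
pose E_ n := [set H : B | carrier H (h ^ c n)].
have mE_ n : measurable (E_ n) by exact: measurable_carrier.
have svh : size v = size (h v) by rewrite size_aut.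
have vhv : v != h v by rewrite eq_sym.
have muEI n : mu (E_ n `&` I n) = mu (E `&` I n).
  have [d dc <-] := irs_conj (sgV sG (Gc n)) (measurableI _ _ mE (mI n)).
  congr (mu _); apply/funext => H; rewrite /preimage /mkset /setI /E_ /E /I /mkset.
  rewrite carrier_conj dc; congr and; first by rewrite /conjS /mkset invgK.
  apply/propext; split=> nI j; have := nI j; congr not.
    by rewrite -embV (left_coord_conjS br) //; exact: sgV.
  by rewrite -embV (left_coord_conjS br) //; exact: sgV.
have trivEI : trivIset setT (fun n => E_ n `&` I n).
  apply/trivIsetP => i j _ _; wlog ij : i j / (i < j)%N.
    move=> wl ne; have [ij|ji|ij] := ltngtP i j; first exact: wl.
      by rewrite setIC; apply: wl => //; rewrite eq_sym.
    by rewrite ij eqxx in ne.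
  (* If [h ^ c i] and [h ^ c j] are both in [H], their quotient has first coordinate
     [r j * (r i)^-1], against [I j]. *)
  move=> _; rewrite -subset0 => H [[Ei _] [Ej Ij]].
  apply: (Ij (Ordinal ij)); split => /=; first by apply: sgM => //; exact: sgV.
  exists ((r j ^ sec h v)^-1 * (r i ^ sec h v)); first by apply: sgM => //; exact: sgV.
  rewrite (embM (h v)) embV -/(c i) -/(c j).
  have sH := carrier_sub H.
  have := sgM sH Ej (sgV sH Ei); congr carrier.
  have cn n : h ^ c n = (c n)^-1 * emb v (r n) * h.
    by rewrite conjgE (cE n) !conjgE !mulgA mulgK.
  have C x y : commute (emb v x) (emb (h v) y) by apply: emb_commute_eqsize.
  rewrite !cn !invgM invgK !mulgA mulgK; congr mulg.
  rewrite -mulgA -[(emb v (r i))^-1]embV -embM /c -embV.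
  exact/esym/C.
(* By invariance the series is the total mass of disjoint events. *)
have sumlt : (\sum_(n <oo) mu (E `&` I n) < +oo)%E.
  rewrite (eq_eseriesr (fun n _ => esym (muEI n))).
  rewrite -measure_semi_bigcup //; last 2 first.
  - by move=> n; exact: measurableI.
  - by apply: bigcupT_measurable => n; exact: measurableI.
  apply: le_lt_trans (probability_le1 _ _) _; last by rewrite ltry.
  by apply: bigcupT_measurable => n; exact: measurableI.
have mEI n : measurable (E `&` I n) by exact: measurableI.
exists (lim_sup_set (fun n => E `&` I n)); split.
- apply: bigcapT_measurable => n; exact: bigcup_measurable.
- exact: lim_sup_set_cvg0.
move=> H /= /not_implyP [HE nfin]; apply: contrapT => nlim; apply: nfin.
have [N NP] : exists N, forall n, (N <= n)%N -> ~ I n H.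
  apply: contrapT => nN; apply: nlim => N _; apply: contrapT => nEI; apply: nN.
  by exists N => n Nn In; apply: nEI; exists n.
have sL := left_coord_sub br svh vhv (carrier_sub H).
set L := left_coord _ _ _ _ in sL *.
(* The least index in the coset of [y] satisfies [I], so it cannot exceed [N]; moreover ['I_N.+1] is
   inhabited, as the choice below requires. *)
have min_lt y : K y -> exists2 i : 'I_N.+1, True & L (y * (r i)^-1).
  move=> Ky; have ex : exists n, `[< L (y * (r n)^-1) >].
    by have [n rn] := rP y Ky; exists n; apply/asboolP; rewrite rn mulgV; exact: sg1.
  case: (ex_minnP ex) => n /asboolP Ln nmin.
  have nN : (n < N.+1)%N.
    rewrite ltnS leqNgt; apply/negP => Nn; apply: (NP n (ltnW Nn)) => j Lj.
    have : (n <= j)%N.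
      apply: nmin; apply/asboolP.
      have -> : y * (r j)^-1 = (y * (r n)^-1) * (r n * (r j)^-1).
        by rewrite mulgA mulgVK.
      exact: sgM.
    by rewrite leqNgt ltn_ord.
  by exists (Ordinal nN).
have [cl clP] : {cl : tree_aut q -> 'I_N.+1 & forall y, K y -> L (y * (r (cl y))^-1)}.
  apply: (@choice _ _ (fun y i => K y -> L (y * (r (nat_of_ord i))^-1))) => y.
  have [Ky|nKy] := pselect (K y); last by exists ord0.
  by have [i _ Li] := min_lt y Ky; exists i.
exists 'I_N.+1, cl => x y Kx Ky exy; have Lx := clP x Kx; have Ly := clP y Ky.
have -> : x * y^-1 = (x * (r (cl x))^-1) * (y * (r (cl y))^-1)^-1.
  by rewrite exy invgM invgK mulgA mulgVK.
by apply: sgM => //; exact: sgV.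
Qed.

Lemma ae_fix_bad_tree :
  {ae mu, forall H, forall h u, carrier H h -> bad_tree K (carrier H) u -> h u = u}.
Proof.
have : {ae mu, forall H, forall h, Gam h -> forall v, carrier H h -> h v != v ->
    fin_idx K (left_coord K (carrier H) v (h v))}.
  apply: ae_forall_gen => // h Gh; apply: ae_forall_countType => v.
  have [/eqP e|hv] := boolP (h v == v); first exact: aeW.
  by have := ae_fin_idx_left_coord Gh hv; apply: ae_imply => H + Hh _; exact.
apply: ae_imply => H fH h u Hh bu; apply/eqP; apply: contrapT => /negP hu; apply: bu.
apply: (eventually_good_moved br (carrier_sub H) _ Hh hu) => v h' Hh'.
by apply: fH => //; exact: carrier_gen Hh'.
Qed.

End IRS.

(** * Germs along the bad tree *)

(** An element of this kind that fixes a single letter is trivial. *)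
Definition free_letters q (r : tree_aut q) : Prop :=
  r = 1 \/ forall i, r [:: i] <> [:: i].

Definition level_transitive q (Gam : set (tree_aut q)) : Prop :=
  forall u v, size u = size v -> exists2 g, Gam g & g u = v.

(* D together with the elements acting freely on letters contains the nucleus;
   a nontrivial d in D has a nontrivial germ only at the ray om^oo, near which
   it moves infinitely many subtrees hanging off that ray. *)
Record spinal q (Gam D : set (tree_aut q)) (om : 'I_q) : Prop := Spinal {
  sp_level : forall g, Gam g -> exists n, forall v, size v = n ->
    D (sec g v) \/ free_letters (sec g v);
  sp_next : forall d i, D d ->
    if i == om then D (sec d [:: i]) else free_letters (sec d [:: i]);
  sp_inf : forall d, D d -> d <> 1 -> forall k0, exists k i,
    [/\ (k0 <= k)%N, i <> om & sec d (rcons (nseq k om) i) <> 1] }.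

Lemma take_mkseq (T : Type) (f : nat -> T) k n : (k <= n)%N ->
  take k (mkseq f n) = mkseq f k.
Proof. by move=> kn; rewrite /mkseq -map_take take_iota (minn_idPl kn). Qed.

Section Holes.
Variables (R : realType) (q m0 m1 : nat) (S K : set (tree_aut q)).
Local Notation Gam := (gen_set S).
Local Notation G := (gen_group S).
Local Notation B := (BorelSub G).
Hypothesis Gcount : exists e : nat -> G, forall c, exists n, e n = c.
Hypothesis br : branching Gam K m0 m1.
Variable mu : probability B R.
Hypothesis irs : is_IRS mu.
Implicit Types (H : B) (g h x y : tree_aut q) (u v w : seq 'I_q).

Let sG := br_Gam br.
Local Notation bad H := (bad_tree K (carrier H)).

(** The letter [i] automatically leaves [u]: the prefix of [u] of length [k.+1] is bad, so a child
    of [take k u] that is not bad is a sibling of it. *)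
Definition holes (N : set nat) u : set B :=
  [set H | bad H u /\ forall k : 'I_(size u), N k ->
     exists i, ~ bad H (rcons (take k u) i)].

Lemma measurable_holes N u : measurable (holes N u).
Proof.
apply: measurableI; first exact: measurable_bad_tree br _.
apply: measurable_forall => k; apply: measurable_imp => _.
by apply: measurable_exists => i; apply: measurable_not; exact: measurable_bad_tree br _.
Qed.

Lemma holes_rcons N u i : holes N (rcons u i) `<=` holes N u.
Proof.
rewrite -cats1 => H [/bad_tree_prefix bu hu]; split; first exact: bu br.
move=> k Nk; have ku : (k < size (u ++ [:: i]))%N.
  by rewrite size_cat addn1 ltnS ltnW.
have [j] := hu (Ordinal ku) Nk; rewrite /= takel_cat ?(ltnW (ltn_ord k)) //.
by exists j.
Qed.

(** Conjugating [H] by an element that takes [u] to [v] carries the bad tree and its holes along. *)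
Lemma mu_holes N u v : size u = size v -> level_transitive Gam ->
  mu (holes N u) = mu (holes N v).
Proof.
move=> suv tr; have [g Gg guv] := tr u v suv.
have [c cg <-] := irs_conj irs Gg (measurable_holes N v).
congr (mu _); apply/funext => H; rewrite /preimage /mkset /holes /mkset.
rewrite carrier_conj cg -guv (bad_tree_conjS br) //.
have hE w : (exists i, ~ bad_tree K (conjS g (carrier H)) (rcons (g w) i)) <->
    (exists i, ~ bad H (rcons w i)).
  split=> -[i ni].
    have [j ej] := aut_rcons g^-1 (g w) i; exists j; rewrite autK in ej.
    by rewrite -ej -(bad_tree_conjS br _ _ Gg) autKV.
  by have [j ej] := aut_rcons g w i; exists j; rewrite -ej (bad_tree_conjS br).
apply/propext; split=> -[bu hu]; split => // k Nk.
  have ku : (k < size u)%N by have := ltn_ord k; rewrite {2}size_aut.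
  by rewrite -aut_take; apply/hE; exact: (hu (Ordinal ku)).
have ku : (k < size (g u))%N by have := ltn_ord k; rewrite size_aut.
by apply/hE; rewrite aut_take; exact: (hu (Ordinal ku)).
Qed.

Lemma mu_holesE N u : mu (holes N u) = (fine (mu (holes N u)))%:E.
Proof. by rewrite fineK // fin_num_measure //; exact: measurable_holes. Qed.

(** The [q] one-letter extensions have the same probability [b'], and a hole at level [n] prevents
    all of them from being bad at once. The union bound over the failures gives
    [b <= q * (b - b')]. *)
Lemma holes_step N (rho : nat -> 'I_q) n : level_transitive Gam -> N n ->
  (fine (mu (holes N (mkseq rho n.+1))) <=
   (1 - q%:R^-1) * fine (mu (holes N (mkseq rho n))))%R.
Proof.
move=> tr Nn; set u := mkseq rho n; set b := fine (mu (holes N u)).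
set b' := fine _.
have q0 : (0 < q)%N by exact: leq_trans (ltn_ord (rho 0%N)).
(* The union bound runs over natural numbers, so indices are decoded to letters; the default is
   never reached below [q]. *)
pose let_ i := odflt (rho 0%N) (insub i).
pose A i := holes N u `\` holes N (rcons u (let_ i)).
have mA i : measurable (A i).
  by apply: measurableD; exact: measurable_holes.
have muA i : mu (A i) = (b - b')%:E.
  rewrite measureD; [|exact: measurable_holes|exact: measurable_holes|].
    rewrite setIidr; last exact: holes_rcons.
    rewrite EFinB; congr (_ - _)%E; first exact: mu_holesE.
    transitivity (mu (holes N (mkseq rho n.+1))); last exact: mu_holesE.
    by apply: mu_holes => //; rewrite size_rcons !size_mkseq.
  by apply: le_lt_trans (probability_le1 _ (measurable_holes _ _)) _; rewrite ltry.
have sub : holes N u `<=` \big[setU/set0]_(i < q) A i.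
  move=> H Hu; rewrite -bigcup_mkord; apply: contrapT => nA.
  have all_i i : holes N (rcons u i) H.
    apply: contrapT => ni; apply: nA; exists (nat_of_ord i) => /=; first exact: ltn_ord.
    by split => //; rewrite /let_ valK.
  have [_ hu] := all_i (rho 0%N).
  have nu : (n < size (rcons u (rho 0%N)))%N by rewrite size_rcons size_mkseq.
  have tu : take n (rcons u (rho 0%N)) = u.
    by rewrite -cats1 take_size_cat // size_mkseq.
  have [j] := hu (Ordinal nu) Nn; rewrite /= tu.
  by apply; have [] := all_i j.
have : (mu (holes N u) <= \sum_(i < q) mu (A i))%E.
  apply: le_trans (Boole_inequality _ _) => //.
  apply: le_measure => //; rewrite inE; first exact: measurable_holes.
  by apply: bigsetU_measurable => i _; exact: mA.
rewrite mu_holesE -/b (eq_bigr (fun=> (b - b')%:E)) // sumEFin lee_fin.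
rewrite sumr_const card_ord => le.
have qR : (0 < q%:R :> R)%R by rewrite ltr0n.
rewrite mulrBl mul1r lerBrDr -lerBrDl ler_pdivrMl // mulr_natl.
exact: le.
Qed.

(** Each of the infinitely many levels in [N] contributes a factor [1 - q^-1], so the probabilities
    fall below every power of it. *)
Lemma ae_holes (N : set nat) (rho : nat -> 'I_q) : level_transitive Gam ->
  (forall k0, exists2 k, (k0 <= k)%N & N k) ->
  {ae mu, forall H, ~ ((forall k, bad H (mkseq rho k)) /\
     forall k, N k -> exists i, ~ bad H (rcons (mkseq rho k) i))}.
Proof.
move=> tr Ninf.
pose b n := fine (mu (holes N (mkseq rho n))).
pose X := [set H : B | (forall k, bad H (mkseq rho k)) /\
     forall k, N k -> exists i, ~ bad H (rcons (mkseq rho k) i)].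
have q0 : (0 < q)%N by exact: leq_trans (ltn_ord (rho 0%N)).
have mX : measurable X.
  apply: measurableI.
    by apply: measurable_forall => k; exact: measurable_bad_tree br _.
  apply: measurable_forall => k; apply: measurable_imp => _.
  by apply: measurable_exists => i; apply: measurable_not; exact: measurable_bad_tree br _.
have mXE : mu X = (fine (mu X))%:E by rewrite fineK // fin_num_measure.
have Xb n : (fine (mu X) <= b n)%R.
  rewrite -lee_fin -mXE -mu_holesE; apply: le_measure => //; rewrite ?inE //.
    exact: measurable_holes.
  move=> H [bk hk]; split=> // k Nk; rewrite take_mkseq; first exact: hk.
  exact: ltnW (leq_trans (ltn_ord k) (eq_leq (size_mkseq _ _))).
have b_dec n m : (n <= m)%N -> (b m <= b n)%R.
  move=> nm; rewrite -lee_fin /b -!mu_holesE; apply: le_measure => //;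
    rewrite ?inE; try exact: measurable_holes.
  elim: m nm => [|m IH]; first by rewrite leqn0 => /eqP ->.
  rewrite leq_eqVlt => /orP [/eqP -> //|nm].
  by apply: subset_trans (IH nm); rewrite mkseqS; exact: holes_rcons.
set c := (1 - q%:R^-1)%R : R.
have c0 : (0 <= c)%R.
  by rewrite subr_ge0 invf_le1 ?ltr0n // ler1n.
have c1 : (`|c| < 1)%R.
  by rewrite ger0_norm // gtrBl invr_gt0 ltr0n.
have bc k : exists n, (b n <= c ^+ k)%R.
  elim: k => [|k [n bn]].
    exists 0%N; rewrite expr0 -lee_fin -mu_holesE; apply: probability_le1.
    exact: measurable_holes.
  have [m nm Nm] := Ninf n; exists m.+1; rewrite exprS.
  apply: le_trans (holes_step rho tr Nm) _; apply: ler_wpM2l => //.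
  exact: le_trans (b_dec _ _ nm) bn.
have X0 : mu X = 0%E.
  apply/eqP; rewrite mXE; apply/eqP; congr EFin; apply/eqP.
  rewrite eq_le fine_ge0 ?measure_ge0 // andbT leNgt; apply/negP => x0.
  have /cvgrPdist_lt /(_ _ x0) [k _ /(_ k (leqnn k))] := cvg_expr c1.
  rewrite /= sub0r normrN ger0_norm ?exprn_ge0 // => ck.
  have [n bn] := bc k.
  by have := lt_le_trans ck (le_trans (Xb n) bn); rewrite ltxx.
exists X; split => // H /= nH; exact: contrapT nH.
Qed.

Variables (D : set (tree_aut q)) (om : 'I_q).
Hypothesis sp : spinal Gam D om.
Hypothesis tr : level_transitive Gam.

(** If the germ of [g] were nontrivial at bad vertices of every depth, these would follow a ray
    [u om om ...]. By [sp_inf] infinitely many side branches of it carry nontrivial sections; such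
    branches cannot be bad, so they are holes, which [ae_holes] excludes. *)
Lemma ae_germ : {ae mu, forall H, forall g, Gam g ->
  (forall u, bad H u -> g u = u) ->
  exists n, forall u, size u = n -> bad H u -> sec g u = 1}.
Proof.
(* [mkseq (nth om u) k] is the prefix of length [k] of the ray [u om om ...], thanks to the default
   of [nth]. *)
pose N g u := [set k | (size u <= k)%N /\
  exists2 i, i <> om & sec g (rcons (mkseq (nth om u) k) i) <> 1].
have : {ae mu, forall H, forall g, Gam g -> forall u,
    (forall k0, exists2 k, (k0 <= k)%N & N g u k) ->
    ~ ((forall k, bad H (mkseq (nth om u) k)) /\
     forall k, N g u k -> exists i, ~ bad H (rcons (mkseq (nth om u) k) i))}.
  apply: ae_forall_gen => // g Gg; apply: ae_forall_countType => u.
  have [inf|ninf] := pselect (forall k0, exists2 k, (k0 <= k)%N & N g u k).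
    by have := ae_holes (nth om u) tr inf; apply: ae_imply.
  exact: aeW.
apply: ae_imply => H aeH g Gg gfix.
(* A bad vertex has a bad child, which [g] fixes. *)
have notfree u : bad H u -> free_letters (sec g u) -> sec g u = 1.
  move=> bu [//|nf]; have [[|i [|? ?]] // _ bui] := bad_tree_extend br 1 bu.
  case: (nf i); have := gfix _ bui; rewrite aut_cat gfix // => /eqP.
  by rewrite eqseq_cat // eqxx => /eqP.
(* A nontrivial section at the bad vertex [u ++ w] forces sections in [D] all the way from [u], and
   these persist only along [om]. *)
have on_ray u w : D (sec g u) \/ free_letters (sec g u) ->
    bad H (u ++ w) -> sec g (u ++ w) <> 1 -> D (sec g u) /\ w = nseq (size w) om.
  elim: w u => [|i w IH] u uD buw suw.
    rewrite cats0 in buw suw; split => //; case: uD => // fu.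
    by case: suw; exact: notfree.
  have bu := bad_tree_prefix br buw.
  have su : sec g u <> 1.
    by move=> s1; apply: suw; rewrite sec_cat s1 sec1.
  have Du : D (sec g u) by case: uD => // fu; case: su; exact: notfree.
  rewrite -cat1s catA in buw suw.
  have := sp_next sp i Du; rewrite -sec_cat; case: eqP => [io|_] h.
    by have [_ ew] := IH _ (or_introl h) buw suw; split => //=; rewrite -ew io.
  case: suw; rewrite sec_cat notfree ?sec1 //; exact: (bad_tree_prefix br buw).
have [n nP] := sp_level sp Gg.
have triv u : bad H u -> sec g u = 1 -> forall v, sec g (u ++ v) = 1.
  by move=> bu su v; rewrite sec_cat su sec1.
have [u m m' mm' mP w sw bw|u su|m mP] := words_uniform (I := 'I_q) (n := n)
    (P := fun u m => forall w, size w = m -> bad H (u ++ w) -> sec g (u ++ w) = 1).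
- rewrite -(cat_take_drop m w) catA in bw *.
  apply: triv; first exact: (bad_tree_prefix br bw).
  apply: mP; first by rewrite size_takel // sw.
  exact: (bad_tree_prefix br bw).
- apply: contrapT => nm.
  have ray m : bad H (u ++ nseq m om) /\ sec g (u ++ nseq m om) <> 1.
    apply: contrapT => nb; apply: nm; exists m => w sw bw; apply: contrapT => nw.
    have [_ ew] := on_ray u w (nP u su) bw nw.
    by apply: nb; rewrite -sw -ew.
  have rayE k : mkseq (nth om u) (size u + k) = u ++ nseq k om.
    rewrite /mkseq iotaD map_cat -/(mkseq _ _) mkseq_nth; congr cat.
    apply: (@eq_from_nth _ om) => [|j]; rewrite size_map size_iota ?size_nseq // => jk.
    by rewrite (nth_map 0%N) ?size_iota // nth_iota // nth_default ?leq_addr // nth_nseq jk.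
  have [bu su1] := ray 0%N; rewrite cats0 in bu su1.
  have [Du _] : D (sec g u) /\ [::] = nseq 0 om.
    by apply: on_ray; rewrite ?cats0 //; exact: nP.
  apply: (aeH g Gg u).
    move=> k0; have [k [i [k0k iom sk]]] := sp_inf sp Du su1 k0.
    exists (size u + k)%N; first exact: leq_trans k0k (leq_addl _ _).
    split; first exact: leq_addr.
    by exists i => //; rewrite rayE -cats1 -catA cats1 sec_cat.
  split=> [k|k [uk [i iom si]]].
    have [bk _] := ray k; rewrite -rayE in bk.
    apply: (bad_tree_prefix br (v := drop k (mkseq (nth om u) (size u + k)))).
    by rewrite -{1}(take_mkseq (nth om u) (leq_addl (size u) k)) cat_take_drop.
  (* A bad side branch with nontrivial section would contradict [on_ray], its last letter not being
     [om]. *)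
  exists i => bi; move: si; rewrite -(subnKC uk) rayE in bi *.
  rewrite -cats1 in bi *; have := ray (k - size u)%N => -[b1 s1] s2.
  have [_ /eqP] := on_ray u (nseq (k - size u) om ++ [:: i]) (nP u su)
    (eq_ind _ (bad H) bi _ (esym (catA _ _ _))) (eq_ind _ (fun z => sec g z <>
      1) s2 _ (esym (catA _ _ _))).
  rewrite size_cat size_nseq addn1 -addn1 nseqD eqseq_cat // eqxx /= => /eqP [].
  exact: iom.
exists (n + m)%N => u su bu; rewrite -(cat_take_drop n u) in bu *; apply: mP => //.
  by rewrite size_takel // su leq_addr.
by rewrite size_drop su addKn.
Qed.

End Holes.

(** * Approximation by finite index subgroups *)

Section Approximation.
Variables (R : realType) (q m0 m1 : nat) (S K : set (tree_aut q)).
Local Notation Gam := (gen_set S).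
Local Notation G := (gen_group S).
Local Notation B := (BorelSub G).
Hypothesis Gcount : exists e : nat -> G, forall c, exists n, e n = c.
Hypothesis br : branching Gam K m0 m1.
Implicit Types (H : B) (g h x y : tree_aut q) (u v w : seq 'I_q).

Let sG := br_Gam br.
Local Notation appr n H := (cong_approx Gam K n (carrier H)).

Lemma approx_subgroup n H :
  (fun c : G => `[< appr n H (val c) >]) \in subgroup_set G.
Proof.
apply/mem_set.
have sA := cong_approx_sub br n (carrier_sub H) (@carrier_gen _ _ H).
split; first by rewrite unfold_in; apply/asboolP; exact: sg1 sA.
move=> x y; rewrite !unfold_in => /asboolP Ax /asboolP Ay; apply/asboolP.
by apply: (sgM sA) => //; exact: (sgV sA).
Qed.

Definition approx_map n (H : B) : B :=
  exist (fun L => L \in subgroup_set G) _ (approx_subgroup n H).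

Lemma mem_approx_map n H (c : G) :
  (c \in mem_sub (approx_map n H)) = `[< appr n H (val c) >].
Proof. by []. Qed.

Lemma approx_map_conj n (c : G) H :
  approx_map n (conj_sub c H) = conj_sub c (approx_map n H).
Proof.
apply/val_inj/funext => x; rewrite [LHS]/= [RHS]/=.
rewrite -[RHS]/(`[< appr n H (val (x ^ c^-1)) >]); apply: asbool_equiv_eq.
by rewrite carrier_conj (cong_approx_conjS br) //; exact: gen_set_val.
Qed.

(** Membership in [Gam] is made explicit so that the quantifier over [h] becomes countable. *)
Lemma measurable_approx n g : measurable [set H : B | appr n H g].
Proof.
have -> : [set H : B | appr n H g] =
    [set H : B | exists2 h, Gam h & cong_sub Gam K n (h^-1 * g) /\ trunc K n (carrier H) h].
  apply/seteqP; split => H /= [h]; last by move=> _ []; exists h.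
  by move=> Ah Nh; exists h => //; case: Ah => /carrier_gen.
apply: measurable_exists_gen => // h _; apply: measurable_andP => _.
apply: measurableI; first exact: measurable_carrier.
apply: measurable_forall => u; apply: measurable_imp => _.
apply: measurableU; first exact: measurable_good br _.
exact: measurable_Prop.
Qed.

(* approx_map n H contains the finite index subgroup cong_sub n, so it is
   determined by its elements among finitely many coset representatives. *)
Lemma measurable_approx_map n : measurable_fun setT (approx_map n).
Proof.
have [C [c [rep [_ Grep repP]]]] := fin_idx_reps (sg1 sG) (fin_idx_cong br n).
have sA H := cong_approx_sub br n (carrier_sub H) (@carrier_gen _ _ H).
have NA H := @cong_sub_approx _ Gam K n _ (carrier_sub H).
have apprE H x : Gam x -> appr n H x = appr n H (rep (c x)).
  by move=> Gx; rewrite -{1}(mulgVK (rep (c x)) x) sgMl //; exact/NA/repP.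
have det H H' : (forall i, appr n H (rep i) <-> appr n H' (rep i)) ->
    approx_map n H = approx_map n H'.
  move=> HH'; apply/val_inj/funext => x; rewrite [LHS]/= [RHS]/=.
  apply: asbool_equiv_eq.
  by rewrite (apprE H _ (gen_set_val x)) (apprE H' _ (gen_set_val x)).
move=> _ Y mY; rewrite setTI.
(* A union over the finitely many membership patterns [b], keeping those realized by a point with
   image in [Y]; this last condition is constant in [H]. *)
have -> : approx_map n @^-1` Y = [set H | exists b : {ffun C -> bool},
    (exists2 H0, Y (approx_map n H0) & forall i, appr n H0 (rep i) <-> b i) /\
    forall i, appr n H (rep i) <-> b i].
  apply/seteqP; split => H /=.
    move=> YH; have bP i : appr n H (rep i) <-> [ffun i => `[< appr n H (rep i) >]] i.
      by rewrite ffunE; split=> /asboolP.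
    by exists [ffun i => `[< appr n H (rep i) >]]; split => //; exists H.
  move=> [b [[H0 YH0 bH0] bH]]; rewrite (@det H H0) // => i.
  by rewrite bH bH0.
apply: measurable_exists => b; apply: measurable_andP => _.
apply: measurable_forall => i; case: (b i).
  have -> : [set H : B | appr n H (rep i) <-> true] = [set H : B | appr n H (rep i)].
    by apply/seteqP; split => H /= => [[_ h]|h]; [exact: h|split].

  exact: measurable_approx.
have -> : [set H : B | appr n H (rep i) <-> false] = [set H : B | ~ appr n H (rep i)].
  by apply/seteqP; split => H /= => [[h _] /h|h] //; split.
by apply: measurable_not; exact: measurable_approx.
Qed.

Lemma finite_index_cong n (H : B) : (forall c : G, cong_sub Gam K n (val c) ->
  c \in mem_sub H) ->
  finite_index H.
Proof.
move=> NH; have [C [c [rep [cP Grep repP]]]] := fin_idx_reps (sg1 sG) (fin_idx_cong br n).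
have [rp rpP] : {rp : C -> G & forall i, val (rp i) = rep i}.
  apply: (@choice _ _ (fun i r => val r = rep i)) => i.
  exact: gen_set_lift (Grep i).
pose coset (x : G) := [set y : G | y * x^-1 \in mem_sub H].
have /= HG : group_closed (mem_sub H) := set_valP H.
have HV := group_closedV HG; have HM := group_closedM HG.
apply: (@sub_finite_set _ _ ((coset \o rp) @` [set: C])); last first.
  by apply: finite_image.
move=> _ [x _ <-]; exists (c (val x)) => //=.
have xr : x * (rp (c (val x)))^-1 \in mem_sub H.
  by apply: NH; have := repP (val x) (gen_set_val x); rewrite -rpP.
apply/seteqP; split => y /= Hy.
  have -> : y * x^-1 = (y * (rp (c (val x)))^-1) * (x * (rp (c (val x)))^-1)^-1.
    by rewrite invgM invgK mulgA mulgVK.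
  by apply: HM => //; exact: HV.
suff : y * (rp (c (val x)))^-1 \in mem_sub H by [].
have -> : y * (rp (c (val x)))^-1 = (y * x^-1) * (x * (rp (c (val x)))^-1).
  by rewrite mulgA mulgVK.
exact: HM.
Qed.

Variables (D : set (tree_aut q)) (om : 'I_q).
Hypothesis sp : spinal Gam D om.
Hypothesis tr : level_transitive Gam.
Variable mu : probability B R.
Hypothesis irs : is_IRS mu.

Lemma ae_approx_cvg : {ae mu, forall H, approx_map ^~ H @ \oo --> (H : subgroup_space G)}.
Proof.
have fixB := ae_fix_bad_tree Gcount br irs.
have germ := ae_germ Gcount br irs sp tr.
apply: ae_imply2 fixB germ => H fixH germH; apply: cvg_Sub => c.
have [n0 n0P] := cong_approx_cvg br (carrier_sub H) (@carrier_gen _ _ H) fixH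
  germH (gen_set_val c).
exists n0 => n /n0P; rewrite carrier_val => e.
rewrite -[LHS]/(`[< appr n H (val c) >]).
by apply/asboolP/idP => /e.
Qed.

Let approx_mixin n := isMeasurableFun.Build _ _ _ _ _ (measurable_approx_map n).
Let approx_mfun n : {mfun B >-> B} := MeasurableFun.Pack (MeasurableFun.Class
  (approx_mixin n)).

Theorem irs_cosofic : cosofic mu.
Proof.
exists (fun n => [the probability B R of distribution mu (approx_mfun n)]); split.
- move=> n c A mA; rewrite /= /distribution /pushforward /=.
  have -> : approx_map n @^-1` (conj_sub c @^-1` A) = conj_sub c @^-1`
    (approx_map n @^-1` A).
    by apply/funext => H; rewrite /preimage /mkset approx_map_conj.
  apply: irs; rewrite -[X in measurable X]setTI; exact: measurable_approx_map.
(* The null set is the measurable event of not containing [cong_sub n]: it covers the subgroups of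
   infinite index and has empty preimage under [approx_map n]. *)
- move=> n; pose A := [set H : B | ~ forall g, Gam g -> cong_sub Gam K n g -> carrier H g].
  have mA : measurable A.
    apply: measurable_not; apply: measurable_forall_gen => // g _.
    by apply: measurable_imp => _; exact: measurable_carrier.
  exists A; split => //.
    rewrite /= /distribution /pushforward /=.
    have -> : approx_map n @^-1` A = set0; last exact: measure0.
    apply/seteqP; split => // H; apply => g /gen_set_lift [c <-] Ng.
    rewrite carrier_val mem_approx_map; apply/asboolP.
    by apply: cong_sub_approx => //; exact: carrier_sub.
  move=> H /= nfin NH; apply: nfin; apply: (@finite_index_cong n) => c Nc.
  by rewrite -carrier_val; apply: NH => //; exact: gen_set_val.
(* Integrals against the laws are integrals of [f \o approx_map n] against [mu], to which dominated
   convergence applies with a constant bound. *)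
- move=> f cf; have [M MP] := continuous_bounded_Sub cf.
  have mf := continuous_measurableSub cf.
  have mfn n : measurable_fun setT (f \o approx_map n : B -> R).
    exact: measurableT_comp mf (measurable_approx_map n).
  have iM : mu.-integrable setT (EFin \o cst M : B -> \bar R).
    exact: finite_measure_integrable_cst.
  have ifn n : mu.-integrable setT (EFin \o (f \o approx_map n) : B -> \bar R).
    apply: le_integrable iM => //; first exact/measurable_EFinP.
    by move=> H _; rewrite /= !lee_fin (le_trans (MP _)) // ler_norm.
  have cvg_ae : {ae mu, forall H, [set: B] H ->
      (fun n => (f (approx_map n H))%:E) @ \oo --> (f H)%:E}.
    apply: ae_imply ae_approx_cvg => H HH _.
    apply: cvg_EFin; first exact: nearW.
    exact: (cvg_comp _ _ HH (cf H)).
  have bound_ae : {ae mu, forall H n, [set: B] H ->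
      (`|(f (approx_map n H))%:E| <= (EFin \o cst M) H)%E}.
    by apply: aeW => H n _; rewrite /= lee_fin; exact: MP.
  have [iff _ cvgf] := dominated_convergence measurableT
    (fun n => (measurable_EFinP _ _).2 (mfn n)) ((measurable_EFinP _ _).2 mf)
    cvg_ae iM bound_ae.
  have : (fun n => fine (\int[mu]_H (f (approx_map n H))%:E)%E) @ \oo
     --> fine (\int[mu]_H (f H)%:E)%E.
    apply: fine_cvg; rewrite fineK; first exact: cvgf.
    exact: integrable_fin_num.
  apply: cvg_trans; apply: near_eq_cvg; apply: nearW => n.
  rewrite /Rintegral /= integral_pushforward //.
    exact/measurable_EFinP.
  exact: ifn.
Qed.

End Approximation.

(** * Subgroups of tree automorphisms given by generators *)

Section Generation.
Variables (q : nat) (S : set (tree_aut q)).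
Local Notation Gam := (gen_set S).
Implicit Types (f g h x y k : tree_aut q) (P Q A B : set (tree_aut q)).

Let sG : subgrp Gam := gen_set_sub S.

(** The elements whose right multiplication preserves and reflects [P] form a subgroup containing
    [S]. *)
Lemma gen_set_ind P : P 1 -> (forall g s, S s -> P g -> P (g * s)) ->
  (forall g s, S s -> P g -> P (g * s^-1)) -> Gam `<=` P.
Proof.
move=> P1 PM PV g Gg.
have : [set y | forall h, P h <-> P (h * y)] g.
  apply: gen_set_min Gg => [|s Ss h]; last first.
    by split=> [/PM|/PV] => /(_ s Ss); rewrite ?mulgK.
  split=> [h|x y Px Py h|x Px h]; first by rewrite mulg1.
    by rewrite mulgA; exact: iff_trans (Px h) (Py _).
  by have := Px (h * x^-1); rewrite mulgVK => PE; split=> /PE.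
by move=> /(_ 1) [/(_ P1)]; rewrite mul1g.
Qed.

Lemma gen_set_countable (s : seq (tree_aut q)) :
  (forall g, S g -> exists i, nth 1 s i = g) ->
  exists e : nat -> gen_group S, forall c, exists n, e n = c.
Proof.
move=> Ss.
pose letter (bi : bool * nat) := if bi.1 then nth 1 s bi.2 else (nth 1 s bi.2)^-1.
pose eval (w : seq (bool * nat)) := foldr (fun bi g => letter bi * g) 1 w.
have eval_rcons w bi : eval (rcons w bi) = eval w * letter bi.
  by rewrite /eval; elim: w => [|b w IH] /=; rewrite ?mulg1 ?mul1g // IH mulgA.
have ev : Gam `<=` range eval.
  apply: gen_set_ind; first by exists [::].
    move=> g c Sc [w _ <-]; have [i ei] := Ss c Sc.
    by exists (rcons w (true, i)) => //; rewrite eval_rcons /letter /= ei.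
  move=> g c Sc [w _ <-]; have [i ei] := Ss c Sc.
  by exists (rcons w (false, i)) => //; rewrite eval_rcons /letter /= ei.
have cP n : exists c : gen_group S, forall w, unpickle n = Some w -> Gam (eval
  w) -> val c = eval w.
  case: (unpickle n) => [w|]; last by exists 1.
  have [/gen_set_lift [c ec]|ng] := pselect (Gam (eval w)); first by exists c => _ [<-].
  by exists 1 => _ [<-] /ng.
have [e eP] := @choice _ _ (fun n (c : gen_group S) =>
  forall w, unpickle n = Some w -> Gam (eval w) -> val c = eval w) cP.
exists e => c; have [w _ ew] := ev _ (gen_set_val c).
exists (pickle w); apply: val_inj; rewrite (eP _ w) ?pickleK ?ew //; exact: gen_set_val.
Qed.

Lemma self_similar_gen : (forall s i, S s -> Gam (sec s [:: i])) ->
  forall g i, Gam g -> Gam (sec g [:: i]).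
Proof.
move=> Ss g i Gg; move: i.
have : [set g | forall i, Gam (sec g [:: i])] g.
  apply: gen_set_min Gg => [|s Sa i]; last exact: Ss.
  split=> [i|x y Gx Gy i|x Gx i]; first by rewrite sec1; exact: sg1 sG.
    by rewrite secM; have [j ->] := aut_letter x i; exact: sgM sG _ _ _ _.
  have [j ej] := aut_letter (x^-1) i; have ei : x [:: j] = [:: i] by rewrite -ej autKV.
  by rewrite -ei secV; exact: sgV sG _ _.
by [].
Qed.

Definition normal_in A P : Prop := forall p g, P p -> A g -> P (p ^ g).

Definition secs P i : set (tree_aut q) :=
  [set g | exists s, [/\ P s, s [:: i] = [:: i] & sec s [:: i] = g]].

Lemma secs_sub P i : subgrp P -> subgrp (secs P i).
Proof.
move=> sP; split.
- by exists 1; split; [exact: sg1|by []|exact: sec1].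
- move=> _ _ [s [Ps si <-]] [s' [Ps' si' <-]]; exists (s * s').
  by split; [exact: sgM|rewrite mulgE si|rewrite secM si].
- move=> _ [s [Ps si <-]]; have e : s^-1 [:: i] = [:: i] by rewrite -{1}si autK.
  by exists s^-1; split; [exact: sgV|by []|rewrite -secV si].
Qed.

Definition fractal A i : Prop := A `<=` secs A i.

Lemma fractal_gen i : S `<=` secs Gam i -> fractal Gam i.
Proof. by move=> SG; apply: gen_set_min SG; exact: secs_sub. Qed.

Lemma secs_normal P i : fractal Gam i -> normal_in Gam P -> normal_in Gam (secs P i).
Proof.
move=> fr nP _ g [s [Ps si <-]] /fr [f [Gf fi <-]].
have e : f^-1 [:: i] = [:: i] by rewrite -{1}fi autK.
exists (s ^ f); split; first exact: nP.
  by rewrite conjgE !mulgE e si fi.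
by rewrite !conjgE !secM e si -[in sec f^-1 _]fi secV.
Qed.

(** First letters are moved to [i0], and below [i0] fractality realizes the element that matches the
    tails. *)
Lemma fractal_level_transitive i0 : fractal Gam i0 ->
  (forall i, exists2 g, Gam g & g [:: i0] = [:: i]) -> level_transitive Gam.
Proof.
move=> fr tr.
suff H n u v : size u = n -> size v = n -> exists2 g, Gam g & g u = v.
  by move=> u v suv; exact: (H (size v)).
elim: n u v => [|n IH] [|i u] [|j v] //=.
  by move=> _ _; exists 1; [exact: sg1 sG|].
move=> [su] [sv]; have [a Ga ai] := tr i; have [b Gb bj] := tr j.
have [||g Gg guv] := IH (sec a^-1 [:: i] u) (sec b^-1 [:: j] v); rewrite ?size_aut //.
have [f [Gf fi fg]] := fr g Gg; exists (a^-1 * f * b).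
  by apply: (sgM sG) => //; apply: (sgM sG) => //; exact: (sgV sG).
have ei : a^-1 [:: i] = [:: i0] by rewrite -ai autK.
have ej : b^-1 [:: j] = [:: i0] by rewrite -bj autK.
rewrite !mulgE -cat1s aut_cat ei aut_cat fi fg guv.
by rewrite -ej -aut_cat autKV.
Qed.

Lemma emb_normal_sub P w : subgrp P -> subgrp [set k | P (emb w k)].
Proof.
move=> sP; split; first by rewrite /mkset emb1; exact: sg1.
  by move=> x y; rewrite /mkset embM; exact: sgM.
by move=> x; rewrite /mkset embV; exact: sgV.
Qed.

Lemma emb_normal P i : fractal Gam i -> normal_in Gam P ->
  normal_in Gam [set k | P (emb [:: i] k)].
Proof.
move=> fr nP k g Pk /fr [f [Gf fi <-]].
by rewrite /mkset -{1}fi -embJ; exact: nP.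
Qed.

(** An element taking [w] to [w'] conjugates one copy onto the other; the twist by its section is
    absorbed by normality of [K]. *)
Lemma emb_transitive P K w : level_transitive Gam ->
  (forall g u, Gam g -> Gam (sec g u)) -> normal_in Gam K -> normal_in Gam P ->
  (forall k, K k -> P (emb w k)) ->
  forall w' k, size w' = size w -> K k -> P (emb w' k).
Proof.
move=> tr ss nK nP Pw w' k sw Kk; have [g Gg gw] := tr w w' (esym sw).
rewrite -(conjgKV (sec g w) k).
rewrite -gw -embJ; apply: nP => //; apply: Pw; apply: nK => //.
by apply: (sgV sG); exact: ss.
Qed.

(** The normal closure, like the commutator subgroup [comm] further down, is an intersection of all
    admissible subgroups, so minimality holds by definition. *)
Definition ncl A x : set (tree_aut q) :=
  [set y | forall P, subgrp P -> normal_in A P -> P x -> P y].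

Lemma ncl_sub A x : subgrp (ncl A x).
Proof.
split=> [P sP _ _|y z Ny Nz P sP nP Px|y Ny P sP nP Px]; first exact: sg1.
  by apply: (sgM sP); [exact: Ny|exact: Nz].
by apply: (sgV sP); exact: Ny.
Qed.

Lemma ncl_normal A x : normal_in A (ncl A x).
Proof. by move=> y g Ny Ag P sP nP Px; exact: (nP _ _ (Ny P sP nP Px) Ag). Qed.

Lemma ncl_mem A x : ncl A x x.
Proof. by []. Qed.

Lemma ncl_min A x P : subgrp P -> normal_in A P -> P x -> ncl A x `<=` P.
Proof. by move=> sP nP Px y; apply. Qed.

Definition comm A B : set (tree_aut q) :=
  [set y | forall P, subgrp P -> (forall a b, A a -> B b -> P [~ a, b]) -> P y].

Lemma comm_sub A B : subgrp (comm A B).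
Proof.
split=> [P sP _|y z Ny Nz P sP PC|y Ny P sP PC]; first exact: sg1.
  by apply: (sgM sP); [exact: Ny|exact: Nz].
by apply: (sgV sP); exact: Ny.
Qed.

Lemma comm_mem A B a b : A a -> B b -> comm A B [~ a, b].
Proof. by move=> Aa Bb P _; exact. Qed.

Lemma comm_min A B P : subgrp P -> (forall a b, A a -> B b -> P [~ a, b]) ->
  comm A B `<=` P.
Proof. by move=> sP PC y; apply. Qed.

Lemma comm_normal C A B : normal_in C A -> normal_in C B -> normal_in C (comm A B).
Proof.
move=> nA nB y g Cy Cg P sP PC.
suff : comm A B `<=` [set y | P (y ^ g)] by apply.
apply: comm_min => [|a b Aa Bb]; last first.
  by rewrite /mkset conjRg; apply: PC; [exact: nA|exact: nB].
split; first by rewrite /mkset conj1g; exact: sg1.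
  by move=> x z; rewrite /mkset conjMg; exact: sgM.
by move=> x; rewrite /mkset conjVg; exact: sgV.
Qed.

Lemma commS A A' B B' : A `<=` A' -> B `<=` B' -> comm A B `<=` comm A' B'.
Proof.
move=> AA BB; apply: comm_min => [|a b Aa Bb]; first exact: comm_sub.
by apply: comm_mem; [exact: AA|exact: BB].
Qed.

Lemma comm_subl A B : subgrp A -> normal_in B A -> comm A B `<=` A.
Proof.
move=> sA nA; apply: comm_min => // a b Aa Bb; rewrite commgEl.
by apply: (sgM sA); [exact: (sgV sA)|exact: nA].
Qed.

(** If [s] fixes [i], the commutator of [emb [:: i] a] with [s] only sees the section of [s] at [i].
    Iterated, this passes from commutators with the whole group to [comm K K], once repeated
    sections of [K] cover the group. *)
Lemma comm_emb A B A' i : (forall k, A' k -> A (emb [:: i] k)) ->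
  forall y, comm A' (secs B i) y -> comm A B (emb [:: i] y).
Proof.
move=> AE; apply: comm_min; first exact/emb_normal_sub/comm_sub.
move=> a _ Aa [s [Bs si <-]].
have -> : emb [:: i] [~ a, sec s [:: i]] = [~ emb [:: i] a, s].
  by rewrite !commgEl embM embV embJ si.
by apply: comm_mem => //; exact: AE.
Qed.

Lemma commg_gen P z : subgrp P -> normal_in Gam P -> Gam z ->
  (forall s, S s -> P [~ z, s]) -> forall w, Gam w -> P [~ z, w].
Proof.
move=> sP nP Gz Pz w Gw.
have : [set w | Gam w /\ P [~ z, w]] w; last by case.
apply: gen_set_min Gw => [|s Ss]; last by split; [exact: gen_set_gen|exact: Pz].
split.
- by split; [exact: sg1 sG|rewrite commg1; exact: sg1].
- move=> u v [Gu Pu] [Gv Pv]; split; first exact: sgM sG _ _ _ _.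
  have -> : [~ z, u * v] = [~ z, v] * [~ z, u] ^ v.
    by rewrite !commgEl !conjgE !invgM !mulgA !mulgK.
  by apply: (sgM sP) => //; exact: nP.
- move=> v [Gv Pv]; split; first exact: sgV sG _ _.
  have -> : [~ z, v^-1] = [~ z, v]^-1 ^ v^-1.
    by rewrite invgR !commgEl !conjgE !invgK !mulgA mulgV mul1g.
  by apply: nP; [exact: (sgV sP)|exact: sgV sG _ _].
Qed.

(** Modulo the normal subgroup [P] the generators commute, hence so do all elements. *)
Lemma comm_gen P : subgrp P -> normal_in Gam P ->
  (forall s s', S s -> S s' -> P [~ s, s']) -> comm Gam Gam `<=` P.
Proof.
move=> sP nP PS; apply: comm_min => // x y Gx Gy.
apply: commg_gen => // s Ss; rewrite -invgR; apply: (sgV sP).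
by apply: commg_gen => // [|s' Ss']; [exact: gen_set_gen|exact: PS].
Qed.

(** [N] plays the part of a nucleus: a product of two of its elements returns to [N] after one more
    letter, so depths [n] and [m] for two factors give [(n + m).+1] for their product. *)
Lemma section_level (N : set (tree_aut q)) : S `<=` N -> N 1 ->
  (forall x, N x -> N x^-1) -> (forall x i, N x -> N (sec x [:: i])) ->
  (forall x y i, N x -> N y -> N (sec (x * y) [:: i])) ->
  forall g, Gam g -> exists n, forall v, size v = n -> N (sec g v).
Proof.
move=> SN N1 NV Ns NM.
have Nw x u : N x -> N (sec x u).
  elim: u x => [|i u IH] x Nx; first by rewrite sec_nil.
  by rewrite -cat1s sec_cat; apply: IH; exact: Ns.
have deeper g n n' : (n <= n')%N -> (forall v, size v = n -> N (sec g v)) ->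
    forall v, size v = n' -> N (sec g v).
  move=> nn' gn v sv; rewrite -(cat_take_drop n v) sec_cat; apply: Nw; apply: gn.
  by rewrite size_takel // sv.
apply: gen_set_min => [|s Ss]; last by exists 0%N => v _; exact/Nw/SN.
split.
- by exists 0%N => v _; rewrite sec1.
- move=> x y [n nP] [m mP]; exists (n + m).+1 => v sv.
  have s1 : size (take (n + m) v) = (n + m)%N by rewrite size_takel // sv.
  have : size (drop (n + m) v) = 1%N by rewrite size_drop sv subSnn.
  rewrite -{2}(cat_take_drop (n + m) v) sec_cat secM.
  case: (drop _ _) => [|i [|? ?]] // _; apply: NM.
    exact: (deeper _ _ _ (leq_addr _ _) nP _ s1).
  by apply: (deeper _ _ _ (leq_addl n m) mP); rewrite size_aut.
- move=> x [n nP]; exists n => v sv; have := secV x (x^-1 v); rewrite autKV => ->.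
  by apply: NV; apply: nP; rewrite size_aut.
Qed.

End Generation.

Lemma fin_idx_of_reps (G : groupType) (A L : set G) (I : finType) (r : I -> G) :
  subgrp L -> (forall x, A x -> exists i, L (x * (r i)^-1)) -> fin_idx A L.
Proof.
move=> sL AL.
have cP x : exists o : option I, A x -> exists2 i, o = Some i & L (x * (r i)^-1).
  have [Ax|nAx] := pselect (A x); last by exists None.
  by have [i Li] := AL x Ax; exists (Some i) => _; exists i.
have [c cE] := @choice _ _ (fun x o => A x -> exists2 i, o = Some i & L (x * (r i)^-1)) cP.
exists (option I : finType), c => x y Ax Ay.
have [i -> Lx] := cE x Ax; have [j -> Ly] := cE y Ay => -[ij]; rewrite -ij in Ly.
have -> : x * y^-1 = (x * (r i)^-1) * (y * (r i)^-1)^-1.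
  by rewrite invgM invgK mulgA mulgVK.
by apply: (sgM sL) => //; exact: (sgV sL).
Qed.

Lemma expg_modn (G : groupType) (x : G) n m : x ^+ n = 1 -> x ^+ (m %% n) = x ^+ m.
Proof.
by move=> xn; rewrite [in RHS](divn_eq m n) expgnDr mulnC expgnA xn expg1n mul1g.
Qed.

(** * The first Grigorchuk group *)

Section GrigorchukGroup.

Local Notation a := grig_a.
Local Notation b := grig_b.
Local Notation c := grig_c.
Local Notation d := grig_d.
Local Notation o0 := (ord0 : 'I_2).
Local Notation o1 := (ord_max : 'I_2).

Let S : set (tree_aut 2) := [set g | [\/ g = a, g = b, g = c | g = d]].
Local Notation Gam := (gen_set S).

Lemma ord2P (i : 'I_2) : i = o0 \/ i = o1.
Proof. by case: i => [[|[|n]] ni] //; [left|right]; exact: val_inj. Qed.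

Lemma grig_letters :
  ((a [:: o0] = [:: o1]) * (a [:: o1] = [:: o0])) *
  ((forall i, b [:: i] = [:: i]) * (forall i, c [:: i] = [:: i]) *
   (forall i, d [:: i] = [:: i])).
Proof.
split; last by (do !split) => i; rewrite ?grig_bE ?grig_cE ?grig_dE wreath1E perm1.
by rewrite grig_aE /rooted !wreath1E tpermL tpermR.
Qed.

Lemma grig_secs :
  (forall i, sec a [:: i] = 1) *
  ((sec b [:: o0] = a) * (sec b [:: o1] = c)) *
  ((sec c [:: o0] = a) * (sec c [:: o1] = d)) *
  ((sec d [:: o0] = 1) * (sec d [:: o1] = b)).
Proof.
have ea i : sec a [:: i] = 1 by rewrite grig_aE sec_wreath.
have eb i : sec b [:: i] = pair_fun a c i by rewrite grig_bE sec_wreath.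
have ec i : sec c [:: i] = pair_fun a d i by rewrite grig_cE sec_wreath.
have ed i : sec d [:: i] = pair_fun 1 b i by rewrite grig_dE sec_wreath.
by do !split; rewrite // ?eb ?ec ?ed.
Qed.

Lemma grig_aa : a * a = 1.
Proof.
apply: eq_aut_sec => i; last by rewrite secM !grig_secs sec1 mulg1.
by have [->|->] := ord2P i; rewrite mulgE !grig_letters.
Qed.

Lemma grig_cons w :
  ((b (o0 :: w) = o0 :: a w) * (b (o1 :: w) = o1 :: c w)) *
  ((c (o0 :: w) = o0 :: a w) * (c (o1 :: w) = o1 :: d w)) *
  ((d (o0 :: w) = o0 :: w) * (d (o1 :: w) = o1 :: b w)).
Proof. by do !split; rewrite autE_cons grig_letters grig_secs. Qed.

(** The relations are proved together because the recursion permutes [b], [c], [d]. *)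
Lemma grig_klein_act w :
  [/\ b (b w) = w, c (c w) = w & d (d w) = w] /\
  [/\ b (c w) = d w, c (d w) = b w & d (b w) = c w].
Proof.
have aK v : a (a v) = v by rewrite -mulgE grig_aa.
elim: w => [|i w [[bb cc dd] [bc cd db]]]; first by rewrite !aut_nil.
by have [->|->] := ord2P i; rewrite !grig_cons ?aK ?bb ?cc ?dd ?bc ?cd ?db.
Qed.

Lemma grig_klein :
  ((b * b = 1) * (c * c = 1) * (d * d = 1)) *
  ((c * b = d) * (d * c = b) * (b * d = c)) *
  ((b * c = d) * (c * d = b) * (d * b = c)).
Proof.
have ext (x y : tree_aut 2) : (forall w, x w = y w) -> x = y by exact: tree_aut_ext.
have [bb [cc dd]] : b * b = 1 /\ c * c = 1 /\ d * d = 1.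
  by do !split; apply: ext => w; have [[]] := grig_klein_act w.
have [cb [dc bd]] : c * b = d /\ d * c = b /\ b * d = c.
  by do !split; apply: ext => w; have [_ []] := grig_klein_act w.
do !split => //.
- by rewrite -dc -mulgA cc mulg1.
- by rewrite -bd -mulgA dd mulg1.
- by rewrite -cb -mulgA bb mulg1.
Qed.

Lemma grig_inv : (a^-1 = a) * (b^-1 = b) * (c^-1 = c) * (d^-1 = d).
Proof. by do !split; apply: mulg1_eq; rewrite ?grig_aa ?grig_klein. Qed.

Lemma grig_cancel (g : tree_aut 2) :
  (g * a * a = g) * (g * b * b = g) * (g * c * c = g) * (g * d * d = g).
Proof. by do !split; rewrite -mulgA ?grig_aa ?grig_klein mulg1. Qed.

Lemma grig_gen : (Gam a * Gam b * Gam c * Gam d)%type.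
Proof.
by do !split; apply: gen_set_gen; rewrite /S /mkset;
  [apply: Or41|apply: Or42|apply: Or43|apply: Or44].
Qed.

Let sG : subgrp Gam := gen_set_sub S.

Lemma grig_self_similar g i : Gam g -> Gam (sec g [:: i]).
Proof.
have [[[Ga Gb] Gc] Gd] := grig_gen.
apply: self_similar_gen => s j [->|->|->|->]; rewrite ?grig_secs; try exact: sg1 sG;
  by have [->|->] := ord2P j; rewrite grig_secs //; exact: sg1 sG.
Qed.

Lemma grig_self_similar_word g u : Gam g -> Gam (sec g u).
Proof.
elim: u g => [|i u IH] g Gg; first by rewrite sec_nil.
by rewrite -cat1s sec_cat; apply: IH; exact: grig_self_similar.
Qed.

(** [b] yields [a] at the letter 0. Conjugation by [a] exchanges the two sections, so [d], [b], [c]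
    yield [b], [c], [d]. *)
Lemma grig_fractal : fractal Gam o0.
Proof.
have [[[Ga Gb] Gc] Gd] := grig_gen.
have GM x y : Gam x -> Gam y -> Gam (x * y) by exact: sgM sG _ _.
have rot s : Gam s -> (forall i, s [:: i] = [:: i]) ->
    secs Gam o0 (sec s [:: o1]).
  move=> Gs si; exists (a * s * a); split; first by apply: (GM) => //; apply: (GM).
    by rewrite !mulgE !grig_letters si grig_letters.
  by rewrite !secM ?mulgE !grig_letters si !grig_secs mul1g mulg1.
apply: fractal_gen => _ [->|->|->|->].
- by exists b; split; rewrite ?grig_letters ?grig_secs.
- by have := rot _ Gd grig_letters.2.2; rewrite grig_secs.
- by have := rot _ Gb grig_letters.2.1.1; rewrite grig_secs.
- by have := rot _ Gc grig_letters.2.1.2; rewrite grig_secs.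
Qed.

Lemma grig_level_transitive : level_transitive Gam.
Proof.
have [[[Ga _] _] _] := grig_gen.
apply: (fractal_level_transitive grig_fractal) => i.
have [->|->] := ord2P i; first by exists 1; [exact: sg1 sG|].
by exists a => //; rewrite grig_letters.
Qed.

(** This is [(ab)^2], whose normal closure is the classical branching subgroup of the Grigorchuk
    group. *)
Let x := a * b * a * b.
Let K := ncl Gam x.

Let sK : subgrp K := ncl_sub Gam x.
Let nK : normal_in Gam K := ncl_normal (x := x).

Lemma grig_K_sub : K `<=` Gam.
Proof.
have [[[Ga Gb] _] _] := grig_gen.
apply: ncl_min => //; first by move=> y g Gy Gg; exact: sgJ sG _ _.
by apply: (sgM sG) => //; apply: (sgM sG) => //; apply: (sgM sG).
Qed.

(** The right side is visibly in [K], and even a conjugate of a commutator of [x]. It equals the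
    square of [b * a * d * a], which is [(ab, c)], and [c * c = 1]. *)
Lemma grig_emb_x : emb [:: o0] x = x ^ (d * a * b) * x^-1.
Proof.
have -> : x ^ (d * a * b) * x^-1 = (b * a * d * a) * (b * a * d * a).
  rewrite conjgE /x !invgM !grig_inv !mulgA !grig_cancel.
  have bdb g : g * b * d * b = g * d by rewrite -!mulgA grig_klein grig_klein.
  by rewrite bdb.
apply: eq_aut_sec => i; have [->|->] := ord2P i.
- by rewrite emb_self !mulgE !grig_letters.
- by rewrite emb_le // !mulgE !grig_letters.
- by rewrite sec_emb !secM ?mulgE !grig_letters !grig_secs !mulgA !gsimp.
- rewrite sec_emb1 // !secM ?mulgE !grig_letters !grig_secs !mulgA !gsimp.
  by rewrite !grig_klein.
Qed.

Lemma grig_K_emb0 k : K k -> K (emb [:: o0] k).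
Proof.
have [[[Ga Gb] _] Gd] := grig_gen.
apply: (ncl_min (P := [set k | K (emb [:: o0] k)])).
- exact: emb_normal_sub.
- exact: (emb_normal grig_fractal nK).
rewrite /mkset grig_emb_x; apply: (sgM sK); last exact: (sgV sK).
by apply: nK => //; apply: (sgM sG) => //; exact: (sgM sG).
Qed.

Lemma grig_K_emb i k : K k -> K (emb [:: i] k).
Proof.
exact: (emb_transitive (w := [:: o0]) grig_level_transitive
  grig_self_similar_word nK nK grig_K_emb0).
Qed.

(** So [b] is central modulo [K]: among the generators it fails to commute only with [a], and
    [[~ b, a] = x^-1]. *)
Lemma grig_K_commb w : Gam w -> K [~ b, w].
Proof.
have [[[Ga Gb] _] Gd] := grig_gen.
apply: commg_gen => // s [->|->|->|->]; rewrite commgEl conjgE !grig_inv !mulgA.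
- have -> : b * a * b * a = x^-1 by rewrite /x !invgM !grig_inv !mulgA.
  exact: (sgV sK).
- by rewrite grig_klein mul1g grig_klein; exact: sg1 sK.
- by rewrite grig_klein -mulgA grig_klein grig_klein; exact: sg1 sK.
- by rewrite grig_klein -mulgA grig_klein grig_klein; exact: sg1 sK.
Qed.

Lemma grig_ad4 : (a * d) ^+ 4 = 1.
Proof.
apply: eq_aut_sec => i; rewrite !expgS expg0 mulg1; have [->|->] := ord2P i;
  by rewrite ?secM !mulgE !grig_letters ?grig_secs ?mulgA ?gsimp ?grig_klein ?sec1.
Qed.

Lemma grig_finite_index : fin_idx Gam K.
Proof.
have [[[Ga Gb] _] Gd] := grig_gen.
have adX n : exists j : 'I_4, (a * d) ^+ n = (a * d) ^+ j.
  by exists (inord (n %% 4)); rewrite inordK ?ltn_pmod // expg_modn // grig_ad4.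
have bX n : exists i : 'I_2, b ^+ n = b ^+ i.
  by exists (inord (n %% 2)); rewrite inordK ?ltn_pmod // expg_modn // expg2 grig_klein.
have ad3 : (a * d) ^+ 3 = d * a.
  apply: (mulIg (a * d)); rewrite -expgSr grig_ad4.
  by rewrite !mulgA -[d * a * a]mulgA grig_aa mulg1 grig_klein.
(* Modulo [K], [b] is central with square 1 and [c = b * d], while [a] and [d] generate a dihedral
   group with rotation [a * d]; at most 16 normal forms arise. *)
pose X := [set g | exists i j k, K (g * (b ^+ i * (a * d) ^+ j * a ^+ nat_of_bool k)^-1)].
have Xa g : X g -> X (g * a).
  move=> [i [j [k Kg]]]; exists i, j, (~~ k); move: Kg; congr K.
  case: k; rewrite /= ?expg0 ?expg1 ?mulg1 !invgM grig_inv !mulgA ?grig_cancel //.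
have Xd g : X g -> X (g * d).
  (* Without a trailing [a] to absorb it, [d] equals [(a * d) ^+ 3 * a], since
     [(a * d) ^+ 3 = d * a]. *)
  move=> [i [j [k Kg]]]; exists i, (if k then j.+1 else j + 3)%N, (~~ k).
  move: Kg; congr K; case: k => /=.
    rewrite expg0 expg1 mulg1 expgSr !invgM !grig_inv !mulgA.
    by rewrite grig_cancel.
  rewrite expg0 expg1 mulg1 expgnDr ad3 !mulgA !invgM !grig_inv !mulgA.
  by rewrite !grig_cancel.
have Xb g : X g -> X (g * b).
  move=> [i [j [k Kg]]]; exists i.+1, j, k; set z := _ * _ * _ in Kg.
  have Gz : Gam z.
    apply: (sgM sG); [apply: (sgM sG)|]; try exact: (sgX _ sG).
    by apply: (sgX _ sG); exact: (sgM sG).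
  rewrite expgS -(mulgA b) -(mulgA b) -/z.
  have -> : g * b * (b * z)^-1 = g * z^-1 * [~ b, z^-1]^-1.
    by rewrite invgR commgEl conjgE !invgM !invgK !grig_inv !mulgA !mulgVK.
  by apply: (sgM sK) => //; apply: (sgV sK); apply: grig_K_commb; exact: (sgV sG).
have XG : Gam `<=` X.
  apply: gen_set_ind.
  - exists 0%N, 0%N, false; rewrite /= !expg0 !gsimp; exact: sg1 sK.
  - have cE : c = b * d by rewrite grig_klein.
    by move=> g s [->|->|->|->]; rewrite ?cE ?mulgA; auto.
  - have cE : c = b * d by rewrite grig_klein.
    by move=> g s [->|->|->|->]; rewrite grig_inv ?cE ?mulgA; auto.
pose r (z : 'I_2 * 'I_4 * bool) := b ^+ z.1.1 * (a * d) ^+ z.1.2 * a ^+ nat_of_bool z.2.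
apply: (fin_idx_of_reps (r := r)) => // g /XG [i [j [k Kg]]].
have [i' ei] := bX i; have [j' ej] := adX j.
by exists (i', j', k); rewrite /r /= -ei -ej.
Qed.

Lemma grig_x_moves i j : x [:: i; j] != [:: i; j].
Proof.
have a_cons w : (a (o0 :: w) = o1 :: w) * (a (o1 :: w) = o0 :: w).
  by split; rewrite autE_cons grig_letters grig_secs.
rewrite /x !mulgE.
by have [->|->] := ord2P i; have [->|->] := ord2P j;
  rewrite ?(a_cons, grig_cons, grig_letters).
Qed.

Let secsN P : subgrp P -> normal_in Gam P ->
  subgrp (secs P o0) /\ normal_in Gam (secs P o0).
Proof. by move=> sP nP; split; [exact: secs_sub|exact: (secs_normal grig_fractal nP)]. Qed.

(** Round one gives [c * a] and [b * a * d], round two [a * d] and [b], round three the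
    generators. *)
Lemma grig_secs3 : Gam `<=` secs (secs (secs K o0) o0) o0.
Proof.
have [[[Ga Gb] Gc] Gd] := grig_gen.
have [s1 n1] := secsN sK nK; have [s2 n2] := secsN s1 n1; have [s3 n3] := secsN s2 n2.
have ca1 : secs K o0 (c * a).
  exists x; split; first exact: ncl_mem.
    by rewrite /x !mulgE !grig_letters.
  by rewrite /x !secM ?mulgE !grig_letters !grig_secs !gsimp.
have ac1 : secs K o0 (a * c).
  by have := sgV s1 ca1; rewrite invgM !grig_inv.
have bad1 : secs K o0 (b * a * d).
  exists (x ^ (a * c * a)); split.
  - by apply: nK => //; apply: (sgM sG) => //; exact: (sgM sG).
  - by rewrite conjgE /x !invgM !grig_inv !mulgE !grig_letters.
  - rewrite conjgE /x !invgM !grig_inv !secM ?mulgE !grig_letters !grig_secs !gsimp.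
    rewrite !mulgA.
    by rewrite grig_klein.
have ad2 : secs (secs K o0) o0 (a * d).
  exists ((c * a) * (c * a)); split; first exact: (sgM s1).
    by rewrite !mulgE !grig_letters.
  by rewrite !secM ?mulgE !grig_letters !grig_secs !gsimp.
have b2 : secs (secs K o0) o0 b.
  have aba2 : secs (secs K o0) o0 (a * b * a).
    exists ((b * a * d) * (a * c)); split; first exact: (sgM s1).
      by rewrite !mulgE !grig_letters.
    by rewrite !secM ?mulgE !grig_letters !grig_secs !gsimp.
  have := n2 _ _ aba2 Ga.
  by rewrite conjgE grig_inv !mulgA grig_aa mul1g grig_cancel.
have a3 : secs (secs (secs K o0) o0) o0 a.
  by exists b; split; rewrite ?grig_letters ?grig_secs.
have c3 : secs (secs (secs K o0) o0) o0 c.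
  exists (b ^ a); split; first exact: n2.
    by rewrite conjgE grig_inv !mulgE !grig_letters.
  by rewrite conjgE grig_inv !secM ?mulgE !grig_letters !grig_secs !gsimp.
have b3 : secs (secs (secs K o0) o0) o0 b.
  exists ((a * d) * (a * d)); split; first exact: (sgM s2).
    by rewrite !mulgE !grig_letters.
  by rewrite !secM ?mulgE !grig_letters !grig_secs !gsimp.
apply: gen_set_min => // _ [->|->|->|->] //.
by have := sgM s3 c3 b3; rewrite grig_klein.
Qed.

(** Depth 4: [grig_emb_x] puts copies of [K] at the letter 0 inside [comm K Gam], and three uses of
    [comm_emb] replace [Gam] by [K]. *)
Lemma grig_comm w k : size w = 4%N -> K k -> comm K K (emb w k).
Proof.
have [[[Ga Gb] _] Gd] := grig_gen.
have sCG := comm_sub K Gam; have nCG : normal_in Gam (comm K Gam).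
  apply: comm_normal => // y g Gy Gg; exact: sgJ sG _ _.
have xC : comm K Gam (emb [:: o0] x).
  rewrite grig_emb_x -[x in _ * x^-1]conjg1.
  have Gdab : Gam (d * a * b) by apply: (sgM sG) => //; exact: (sgM sG).
  have -> : x ^ (d * a * b) * (x ^ 1)^-1 = ([~ x, d * a * b]) ^ x^-1.
    by rewrite conjg1 commgEl [RHS]conjgE invgK -(mulgA x^-1) mulKVg.
  apply: nCG; first by apply: comm_mem => //; exact: ncl_mem.
  by apply: (sgV sG); apply: grig_K_sub; exact: ncl_mem.
have KC : forall k, K k -> comm K Gam (emb [:: o0] k).
  apply: (ncl_min (P := [set k | comm K Gam (emb [:: o0] k)])) => //.
    exact: emb_normal_sub.
  exact: (emb_normal grig_fractal nCG).
have C3 k' : K k' -> comm K K (emb [:: o0; o0; o0; o0] k').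
  move=> Kk'; rewrite -[_ :: _]/([:: o0] ++ [:: o0] ++ [:: o0] ++ [:: o0]) !emb_cat.
  do 3!apply: (comm_emb grig_K_emb0).
  by apply: (commS _ grig_secs3) (KC _ Kk').
by move=> sw; apply: (emb_transitive (w := [:: o0; o0; o0; o0]) grig_level_transitive
  grig_self_similar_word nK (comm_normal nK nK) C3).
Qed.

Lemma grig_branching : branching Gam K 4 2.
Proof.
split => //.
- by move=> g i; exact: grig_self_similar.
- exact: grig_K_sub.
- exact: grig_finite_index.
- by move=> i k; exact: grig_K_emb.
- by move=> w k sw Kk P sP PC; exact: (grig_comm sw Kk sP PC).
- move=> [|i [|j [|? ?]]] // _; exists x; first exact: ncl_mem.
  exact: grig_x_moves.
Qed.

Let D : set (tree_aut 2) := [set g | [\/ g = 1, g = b, g = c | g = d]].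

Lemma grig_a_free : free_letters a.
Proof. by right=> i; have [->|->] := ord2P i; rewrite grig_letters. Qed.

Lemma grig_spinal : spinal Gam D o1.
Proof.
have D1 : D 1 by apply: Or41.
have Db : D b by apply: Or42.
have Dc : D c by apply: Or43.
have Dd : D d by apply: Or44.
have DM y z : D y -> D z -> D (y * z).
  by move=> [->|->|->|->] [->|->|->|->]; rewrite ?gsimp ?grig_klein.
have Dsec y i : D y -> if i == o1 then D (sec y [:: i])
    else sec y [:: i] = 1 \/ sec y [:: i] = a.
  by move=> [->|->|->|->]; have [->|->] := ord2P i; rewrite /= ?sec1 ?grig_secs; auto.
split.
(* The nucleus [1, a, b, c, d]. *)
- pose N := [set g | D g \/ g = a].
  have Ns y i : N y -> N (sec y [:: i]).
    move=> [Dy|->]; last by rewrite grig_secs; left.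
    by have := Dsec y i Dy; case: ifP => _; [left|move=> [->|->]; [left|right]].
  move=> g Gg; have [n nP] : exists n, forall v, size v = n -> N (sec g v).
  apply: section_level Gg => [||||y z i].
  + by move=> s [->|->|->|->]; [right|left|left|left].
  + by left.
  + by move=> y [[->|->|->|->]|->]; rewrite ?invg1 ?grig_inv; [left|left|left|left|right].
  + exact: Ns.
  + move=> [Dy|->] [Dz|->].
    * by apply: Ns; left; exact: DM.
    * have [j ej] := aut_letter y i; rewrite secM ej grig_secs mulg1.
      by apply: Ns; left.
    * have [j ej] := aut_letter a i; rewrite secM ej grig_secs mul1g.
      by apply: Ns; left.
    * by rewrite grig_aa sec1; left.
  by exists n => v /nP [Dv|->]; [left|right; exact: grig_a_free].
- move=> y i Dy; have := Dsec y i Dy; case: ifP => // _ [->|->]; first by left.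
  exact: grig_a_free.
- have o01 : o0 <> o1 by [].
  have a1 : a <> 1 by move=> /(congr1 (fun f : tree_aut 2 => f [:: o0]));
    rewrite grig_letters.
  have ray k y : [\/ y = b, y = c | y = d] ->
      [\/ sec y (nseq k o1) = b, sec y (nseq k o1) = c | sec y (nseq k o1) = d].
    elim: k y => [|k IH] y yD; first by rewrite sec_nil.
    rewrite -[nseq _ _]/([:: o1] ++ nseq k o1) sec_cat; apply: IH.
    by case: yD => ->; rewrite grig_secs; [apply: Or32|apply: Or33|apply: Or31].
  move=> y Dy y1 k0; have yD : [\/ y = b, y = c | y = d].
    by case: Dy => // ->; [apply: Or31|apply: Or32|apply: Or33].
  have [e|e|e] := ray k0 y yD.
  + by exists k0, o0; split => //; rewrite -cats1 sec_cat e grig_secs.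
  + by exists k0, o0; split => //; rewrite -cats1 sec_cat e grig_secs.
  (* The side section of [d] is trivial, but one letter further along the ray [d] becomes [b], whose
     side section is [a]. *)
  + exists k0.+1, o0; split => //.
    by rewrite -cats1 -[k0.+1]addn1 nseqD 2!sec_cat e !grig_secs.
Qed.

Theorem grigorchuk_irs_cosofic (R : realType) (mu : probability (BorelSub Grigorchuk) R) :
  is_IRS mu -> cosofic mu.
Proof.
apply: (irs_cosofic _ grig_branching grig_spinal grig_level_transitive).
apply: (@gen_set_countable _ _ [:: a; b; c; d]) => g [->|->|->|->].
- by exists 0%N.
- by exists 1%N.
- by exists 2%N.
- by exists 3%N.
Qed.

End GrigorchukGroup.

(** * The Gupta-Sidki groups *)

Lemma free_lettersV q (r : tree_aut q) : free_letters r -> free_letters r^-1.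
Proof.
move=> [->|fr]; first by left; rewrite invg1.
by right=> i ri; apply: (fr i); rewrite -{1}ri autKV.
Qed.

Definition powers (G : groupType) (x : G) : set G := [set y | exists m, y = x ^+ m].

Lemma powersV (G : groupType) (x : G) n : x ^+ n.+1 = 1 -> forall y, powers x y
  -> powers x y^-1.
Proof.
move=> xn _ [m ->]; exists (n * m)%N; rewrite expgnA -expVgn.
by congr (_ ^+ _); apply: mulg1_eq; rewrite -expgS.
Qed.

Section GuptaSidkiGroup.
(** Degrees of the form [n.+3] make the letters 0, 1 and [p.-1] distinct by computation. *)
Variable n : nat.
Local Notation p := n.+3.
Local Notation a := (gs_a p).
Local Notation t := (gs_t p).
Local Notation o0 := (ord0 : 'I_p).
Local Notation om := (ord_max : 'I_p).

Let S : set (tree_aut p) := [set g | g = a \/ g = t].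
Local Notation Gam := (gen_set S).

Let tau (i : 'I_p) := gs_tuple 1 a a^-1 t i.

Lemma gs_a_letter i : a [:: i] = [:: ordS i].
Proof. by rewrite gs_aE /rooted wreath1E permE. Qed.

Lemma gs_a_sec i : sec a [:: i] = 1.
Proof. by rewrite gs_aE sec_wreath. Qed.

Lemma gs_t_letter i : t [:: i] = [:: i].
Proof. by rewrite gs_tE wreath1E perm1. Qed.

Lemma gs_t_sec i : sec t [:: i] = tau i.
Proof. by rewrite gs_tE sec_wreath. Qed.

Lemma gs_t_wreath : t = wreath tau 1.
Proof. exact: gs_tE. Qed.

Lemma gs_aX_letter m i : (a ^+ m) [:: i] = [:: inord ((i + m) %% p)].
Proof.
elim: m => [|m IH].
  by rewrite expg0 addn0 modn_small // inord_val.
rewrite expgSr mulgE IH gs_a_letter; congr [:: _]; apply: val_inj => /=.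
by rewrite !inordK ?ltn_pmod // -addn1 modnDml addn1 addnS.
Qed.

Lemma gs_aX_sec m i : sec (a ^+ m) [:: i] = 1.
Proof.
elim: m i => [|m IH] i; first by rewrite expg0 sec1.
by rewrite expgS secM gs_a_sec gs_a_letter IH mulg1.
Qed.

Lemma gs_aX_p : a ^+ p = 1.
Proof.
apply: eq_aut_sec => i; last by rewrite gs_aX_sec sec1.
by rewrite gs_aX_letter modnDr modn_small // inord_val.
Qed.

Lemma gs_aX_free m : free_letters (a ^+ m).
Proof.
have [pm|npm] := eqVneq (m %% p) 0%N.
  by left; rewrite -(expg_modn _ gs_aX_p) pm expg0.
right=> i; rewrite gs_aX_letter => -[] /(congr1 val) /=.
rewrite inordK ?ltn_pmod // => /eqP.
rewrite -[X in _ == X](modn_small (ltn_ord i)) -[X in _ == (X %% _)]addn0 eqn_modDl mod0n.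
by rewrite (negbTE npm).
Qed.

Lemma gs_tX_letter m i : (t ^+ m) [:: i] = [:: i].
Proof. by elim: m => [|m IH] //; rewrite expgS mulgE gs_t_letter. Qed.

Lemma gs_tX_sec m i : sec (t ^+ m) [:: i] = tau i ^+ m.
Proof.
elim: m => [|m IH]; first by rewrite !expg0 sec1.
by rewrite !expgS secM gs_t_letter IH gs_t_sec.
Qed.

Lemma tau_cases i : [\/ tau i = a, tau i = a^-1, tau i = 1 | tau i = t /\ i = om].
Proof.
rewrite /tau /gs_tuple; case: eqP => _; first exact: Or41.
case: eqP => _; first exact: Or42.
by case: eqP => e; [apply: Or44; split => //; exact: val_inj|apply: Or43].
Qed.

Lemma gs_tX_p : t ^+ p = 1.
Proof.
apply: tree_aut_ext; elim=> [|i w IH]; first by rewrite aut_nil.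
rewrite autE_cons gs_tX_letter gs_tX_sec.
have [->|->|->|[-> _]] := tau_cases i; last by rewrite IH.
- by rewrite gs_aX_p.
- by rewrite expVgn gs_aX_p invg1.
- by rewrite expg1n.
Qed.

Lemma gs_spinal_sets : spinal Gam (powers t) om.
Proof.
have sec_t m i : [\/ exists k, sec (t ^+ m) [:: i] = a ^+ k,
    exists k, sec (t ^+ m) [:: i] = (a ^+ k)^-1 | sec (t ^+ m) [:: i] = t ^+ m /\ i = om].
  rewrite gs_tX_sec; have [->|->|->|[-> ->]] := tau_cases i.
  - by apply: Or31; exists m.
  - by apply: Or32; exists m; rewrite expVgn.
  - by apply: Or31; exists 0%N; rewrite expg1n.
  - by apply: Or33.
split.
- pose N := [set g | powers t g \/ powers a g].
  have aV k : powers a (a ^+ k)^-1 by apply: (powersV gs_aX_p); exists k.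
  have Ns y i : N y -> N (sec y [:: i]).
    move=> [[m ->]|[m ->]]; last by rewrite gs_aX_sec; left; exists 0%N.
    have [[k ->]|[k ->]|[-> _]] := sec_t m i; [right|right|left] => //.
      by exists k.
    by exists m.
  move=> g Gg; have [k kP] : exists k, forall v, size v = k -> N (sec g v).
    apply: section_level Gg => [_ [->|->]||y [yt|ya]|//|y z i [[m ->]|[m ->]]
      [[m' ->]|[m' ->]]].
    + by right; exists 1%N.
    + by left; exists 1%N.
    + by left; exists 0%N.
    + by left; exact: (powersV gs_tX_p).
    + by right; exact: (powersV gs_aX_p).
    + by apply: Ns; left; exists (m + m')%N; rewrite expgnDr.
    + rewrite secM gs_tX_letter gs_aX_sec mulg1; apply: Ns; by left; exists m.
    + rewrite secM gs_aX_sec gs_aX_letter mul1g; apply: Ns; by left; exists m'.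
    + by apply: Ns; right; exists (m + m')%N; rewrite expgnDr.
  by exists k => v /kP [tv|[m ->]]; [left|right; exact: gs_aX_free].
- move=> _ i [m ->]; case: eqP => [->|iom].
    by exists m; rewrite gs_tX_sec /tau /gs_tuple /= eqxx.
  have [[k ->]|[k ->]|[_ /iom //]] := sec_t m i; first exact: gs_aX_free.
  exact/free_lettersV/gs_aX_free.
- move=> _ [m ->] tm1 k0; exists k0, o0; split => //.
  have ray k : sec (t ^+ m) (nseq k om) = t ^+ m.
    elim: k => [|k IH]; first by rewrite sec_nil.
    rewrite -[nseq _ _]/([:: om] ++ nseq k om) sec_cat gs_tX_sec.
    by rewrite /tau /gs_tuple /= eqxx.
  (* The side section at the letter 0 is [a ^+ m]; if it is trivial, then [p] divides [m] and
     [t ^+ m = 1]. *)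
  rewrite -cats1 sec_cat ray gs_tX_sec -[tau o0]/a => am1; apply: tm1.
  have := gs_aX_letter m o0; rewrite am1 => -[] /(congr1 val) /=.
  rewrite add0n inordK ?ltn_pmod // => pm.
  by rewrite -(expg_modn _ gs_tX_p) -pm expg0.
Qed.

Lemma gs_gen_a : Gam a. Proof. by apply: gen_set_gen; left. Qed.
Lemma gs_gen_t : Gam t. Proof. by apply: gen_set_gen; right. Qed.
Hint Resolve gs_gen_a gs_gen_t : core.

Let sG : subgrp Gam := gen_set_sub S.
Let GM x y : Gam x -> Gam y -> Gam (x * y) := @sgM _ _ sG x y.
Let GV x : Gam x -> Gam x^-1 := @sgV _ _ sG x.
Let GJ x y : Gam x -> Gam y -> Gam (x ^ y) := @sgJ _ _ x y sG.

Lemma gs_self_similar g i : Gam g -> Gam (sec g [:: i]).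
Proof.
apply: self_similar_gen => s j [->|->]; first by rewrite gs_a_sec; exact: sg1 sG.
rewrite gs_t_sec; have [->|->|->|[-> _]] := tau_cases j => //; first exact: GV.
exact: sg1 sG.
Qed.

Lemma gs_self_similar_word g u : Gam g -> Gam (sec g u).
Proof.
elim: u g => [|i u IH] g Gg; first by rewrite sec_nil.
by rewrite -cat1s sec_cat; apply: IH; exact: gs_self_similar.
Qed.

Lemma gs_conj_a (f : 'I_p -> tree_aut p) :
  (wreath f 1) ^ a = wreath (fun i => f (ord_pred i)) 1.
Proof.
have aV i : a^-1 [:: i] = [:: ord_pred i].
  by rewrite -[i in LHS](ord_predK i) -gs_a_letter autK.
have aVs i : sec a^-1 [:: i] = 1.
  by rewrite -(ord_predK i) -gs_a_letter secV gs_a_sec invg1.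
apply: eq_aut_sec => i.
  by rewrite conjgE !mulgE aV !wreath1E !perm1 gs_a_letter ord_predK.
by rewrite conjgE !secM aVs aV sec_wreath !wreath1E perm1 gs_a_sec mul1g mulg1 sec_wreath.
Qed.

(** In coordinates [t1] is [(t, a, a^-1, 1, ..., 1)], and [t2] has [t] at the letter 1 and [a] at
    the letter 2. *)
Let t1 := t ^ a.
Let t2 := t1 ^ a.
Let tau1 i := tau (ord_pred i).
Let tau2 i := tau (ord_pred (ord_pred i)).

Lemma gs_t1 : t1 = wreath tau1 1.
Proof. by rewrite /t1 [in LHS]gs_t_wreath gs_conj_a. Qed.

Lemma gs_t2 : t2 = wreath tau2 1.
Proof. by rewrite /t2 gs_t1 gs_conj_a. Qed.

Lemma val_ord_pred (i : 'I_p) :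
  ord_pred i = (if i == 0%N :> nat then p.-1 else i.-1) :> nat.
Proof.
case: i => [[|i] ip] /=; first by rewrite modn_small.
by rewrite ?addSn /= modnDr modn_small // ltnW.
Qed.

Let tauE i : tau i = if i == 0%N :> nat then a else if i == 1%N :> nat then a^-1
  else if i == n.+2 :> nat then t else 1.
Proof. by []. Qed.

Lemma gs_fractal : fractal Gam o0.
Proof.
apply: fractal_gen => _ [->|->].
- by exists t; split; rewrite ?gs_t_letter ?gs_t_sec.
- exists t1; split; [exact: GJ|by rewrite gs_t1 wreath1E perm1|].
  by rewrite gs_t1 sec_wreath /tau1 tauE !val_ord_pred /= eqxx.
Qed.

Lemma gs_level_transitive : level_transitive Gam.
Proof.
apply: (fractal_level_transitive gs_fractal) => i.
exists (a ^+ i); first exact: (sgX _ sG).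
by rewrite gs_aX_letter add0n modn_small // inord_val.
Qed.

Let K := comm Gam Gam.
Let gamma3 := comm K Gam.

Let nGam : normal_in Gam Gam. Proof. by move=> y g Gy Gg; exact: GJ. Qed.
Let sK : subgrp K := comm_sub Gam Gam.
Let nK : normal_in Gam K := comm_normal nGam nGam.
Let sC : subgrp gamma3 := comm_sub K Gam.
Let nC : normal_in Gam gamma3 := comm_normal nK nGam.

Lemma gs_K_sub : K `<=` Gam.
Proof. exact: comm_subl sG nGam. Qed.

Lemma gs_gamma3_sub : gamma3 `<=` K.
Proof. exact: comm_subl sK nK. Qed.

Let z1 := t^-1 * t1.
Let z2 := t^-1 * t2.

Lemma gs_K_z1 : K z1.
Proof. by rewrite /z1 /t1 -commgEl; exact: comm_mem. Qed.

Lemma gs_K_z2 : K z2.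
Proof. by rewrite /z2 /t2 /t1 -conjgM -commgEl; apply: comm_mem => //; exact: GM. Qed.

(** The commutator of [y] with [y * z] only sees [z], so elements that agree modulo [K] have their
    commutator in [gamma3]. *)
Lemma gs_gamma3_comm y z : Gam y -> K z -> gamma3 [~ y, y * z].
Proof.
move=> Gy Kz; have -> : [~ y, y * z] = [~ z, y]^-1.
  by rewrite invgR !commgEl !conjgE !invgM !mulgA mulgVK.
by apply: (sgV sC); exact: comm_mem.
Qed.

Lemma gs_emb_comm (f g : 'I_p -> tree_aut p) :
  (forall i, i != o0 -> commute (f i) (g i)) ->
  [~ wreath f 1, wreath g 1] = emb [:: o0] [~ f o0, g o0].
Proof.
move=> fg; rewrite wreath1R /=; congr wreath; apply/funext => i.
by case: eqVneq => [->//|/fg] /commgP /eqP.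
Qed.

(** For [p > 3], [t] and [t1] commute in every coordinate but the first, where they are [a] and [t].
    For [p = 3] their last coordinates [t] and [a^-1] obstruct this, so
    [t * t1 = (a * t, 1, t * a^-1)] and [t1 * t2 = (t * a^-1, a * t, 1)] replace them. Both pairs
    agree modulo [K]. *)
Lemma gs_gamma3_emb_at : gamma3 (emb [:: o0] [~ a, t]).
Proof.
have nE := emb_normal gs_fractal nC; have sE := emb_normal_sub [:: o0] sC.
have [n0|n0] := posnP n.
- have e : [~ t * t1, t1 * t2] = emb [:: o0] [~ a * t, t * a^-1].
    have := @gs_emb_comm (fun i => tau i * tau1 i) (fun i => tau1 i * tau2 i).
    rewrite -!wreath1M -gs_t_wreath -gs_t1 -gs_t2 => ->.
      rewrite /tau1 /tau2 !tauE !val_ord_pred /= eqxx.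
      by rewrite n0.
    move=> i; rewrite -val_eqE /tau1 /tau2 !tauE !val_ord_pred /= => i0.
    have ii : (i < 3)%N by have := ltn_ord i; rewrite {2}n0.
    have [->|i2] : i = 1%N :> nat \/ i = 2%N :> nat.
      by case: (nat_of_ord i) i0 ii => [|[|[|]]] //; [left|right].
    + by rewrite /= mulVg; exact/commute_sym/commute1.
    + by rewrite i2 n0 /= mulVg; exact: commute1.
  have : gamma3 (emb [:: o0] [~ a * t, t * a^-1]).
    have -> : emb [:: o0] [~ a * t, t * a^-1] = [~ t * t1, t * t1 * (t1^-1 * z1
      * t1 * t1^-1 * t2)].
      have word (x y z : tree_aut p) : x * y * (y^-1 * (x^-1 * y) * y * y^-1 * z) = y * z.
        by rewrite !mulgA !mulgK mulgV mul1g.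
      by rewrite -e /z1 (word t t1 t2).
    apply: gs_gamma3_comm; first by apply: GM => //; exact: GJ.
    have Gt1 : Gam t1 by exact: GJ.
    have word (x y z : tree_aut p) : y^-1 * x * y * y^-1 * z = x ^ y * (y^-1 * z).
      by rewrite conjgE !mulgA.
    rewrite (word z1 t1 t2); apply: (sgM sK); first by apply: nK => //; exact: gs_K_z1.
    have -> : t1^-1 * t2 = z1 ^ a by rewrite /z1 conjMg conjVg.
    by apply: nK => //; exact: gs_K_z1.
  (* Since [t ^+ 3 = 1], the commutator becomes [[~ t^-1, a^-1]], a conjugate of [[~ a, t]^-1]. *)
  have t3 : t^-1 = t * t by have := gs_tX_p; rewrite n0 => t3; apply: mulg1_eq; rewrite -t3.
  have -> : [~ a * t, t * a^-1] = [~ t^-1, a^-1].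
    by rewrite t3 !commgEl !conjgE !invgM !invgK !mulgA mulgVK.
  move=> /nE /(_ (GM gs_gen_t gs_gen_a)) /(sgV sE); congr (gamma3 (emb _ _)).
  rewrite !commgEl !conjgE !invgM !invgK !mulgA.
  by rewrite !mulgVK.
- have e : [~ t, t1] = emb [:: o0] [~ a, t].
    have := @gs_emb_comm tau tau1; rewrite -gs_t_wreath -gs_t1 => ->.
      by rewrite /tau1 !tauE !val_ord_pred /= eqxx.
    move=> i; rewrite -val_eqE /tau1 !tauE !val_ord_pred /= => /negbTE i0; rewrite i0.
    have [i1|i1] := eqVneq (nat_of_ord i) 1%N; first by rewrite i1;
      exact/commute_sym/commuteV.
    have [i2|i2] := eqVneq (nat_of_ord i) n.+2; last exact/commute_sym/commute1.
    rewrite i2 /= eqSS (gtn_eqF n0) (ltn_eqF (ltnSn n.+1)).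
    exact: commute1.
  by rewrite -e -(mulVKg t t1); apply: gs_gamma3_comm => //; exact: gs_K_z1.
Qed.

Lemma gs_gamma3_emb k : K k -> gamma3 (emb [:: o0] k).
Proof.
move=> Kk; suff : K `<=` [set k | gamma3 (emb [:: o0] k)] by apply.
apply: comm_gen; [exact: emb_normal_sub|exact: (emb_normal gs_fractal nC)|].
move=> _ _ [->|->] [->|->]; rewrite /mkset ?commgg ?emb1.
- exact: sg1 sC.
- exact: gs_gamma3_emb_at.
- by rewrite -invgR embV; apply: (sgV sC); exact: gs_gamma3_emb_at.
- exact: sg1 sC.
Qed.

Lemma gs_K_emb i k : K k -> K (emb [:: i] k).
Proof.
apply: (emb_transitive (w := [:: o0]) gs_level_transitive
  gs_self_similar_word nK nK) => // k' Kk'.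
exact: gs_gamma3_sub (gs_gamma3_emb Kk').
Qed.

(** At the letter 0, [z1] gives [a^-1 * t], while [z2] gives [a^-1] for [p > 3] and
    [a^-1 * a^-1 = a] for [p = 3]. *)
Lemma gs_secs_K : Gam `<=` secs K o0.
Proof.
have sS := secs_sub o0 sK.
have z1P : secs K o0 (a^-1 * t).
  exists z1; split; first exact: gs_K_z1.
    by rewrite /z1 gs_t1 gs_t_wreath wreath1V wreath1M wreath1E perm1.
  rewrite /z1 gs_t1 [in LHS]gs_t_wreath wreath1V wreath1M sec_wreath /tau1 !tauE.
  by rewrite !val_ord_pred /= eqxx.
have z2P : secs K o0 (a^-1 * tau2 o0).
  exists z2; split; first exact: gs_K_z2.
    by rewrite /z2 gs_t2 gs_t_wreath wreath1V wreath1M wreath1E perm1.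
  by rewrite /z2 gs_t2 [in LHS]gs_t_wreath wreath1V wreath1M sec_wreath.
have aP : secs K o0 a.
  move: z2P; rewrite /tau2 tauE !val_ord_pred /=.
  have [n0|n0] := posnP n.
    have -> : (n.+1 == 1)%N by rewrite n0.
    rewrite -invgM => z2P; have -> : a = (a * a)^-1; last exact: z2P.
    apply/esym/mulg1_eq; rewrite -mulgA -[LHS]/(a ^+ 3).
    by rewrite (_ : 3%N = p) ?gs_aX_p // n0.
  rewrite eqSS (gtn_eqF n0) (ltn_eqF (ltnSn n.+1)) mulg1 => /(sgV sS).
  by rewrite invgK.
apply: gen_set_min => // _ [->|->] //.
by rewrite -(mulVKg a t); exact: (sgM sS).
Qed.

(** Depth 2: one letter to enter [gamma3], and one more to replace [Gam] by [K], whose sections at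
    the letter 0 already cover the group. *)
Lemma gs_comm w k : size w = 2%N -> K k -> comm K K (emb w k).
Proof.
have C2 k' : K k' -> comm K K (emb [:: o0; o0] k').
  move=> Kk'; rewrite -[_ :: _]/([:: o0] ++ [:: o0]) emb_cat.
  apply: (comm_emb (@gs_K_emb o0)).
  by apply: (commS _ gs_secs_K) (gs_gamma3_emb Kk').
by move=> sw; apply: (emb_transitive (w := [:: o0; o0]) gs_level_transitive
  gs_self_similar_word nK (comm_normal nK nK) C2).
Qed.

Lemma gs_finite_index : fin_idx Gam K.
Proof.
(* Modulo [K] the group is abelian, generated by [a] and [t], both of order dividing [p]. *)
pose X := [set g | exists i j, K (g * (a ^+ i * t ^+ j)^-1)].
have Xt g : X g -> X (g * t).
  move=> [i [j Kg]]; exists i, j.+1; move: Kg; congr K.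
  by rewrite expgSr !invgM !mulgA mulgK.
have Xa g : X g -> X (g * a).
  move=> [i [j Kg]]; exists i.+1, j; set z := a ^+ i * t ^+ j in Kg.
  have Gz : Gam z by apply: GM; exact: (sgX _ sG).
  rewrite expgS -(mulgA a) -/z.
  have -> : g * a * (a * z)^-1 = g * z^-1 * [~ z^-1, a^-1].
    by rewrite commgEl conjgE !invgM !invgK !mulgA !mulgVK.
  by apply: (sgM sK) => //; apply: comm_mem; exact: GV.
have XX s g : (forall g, X g -> X (g * s)) -> X g -> forall m, X (g * s ^+ m).
  move=> Xs Xg; elim=> [|m IH]; first by rewrite expg0 mulg1.
  by rewrite expgSr mulgA; exact: Xs.
have inv (s : tree_aut p) : s ^+ p = 1 -> s^-1 = s ^+ n.+2.
  by move=> sp; apply: mulg1_eq; rewrite -expgS.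
have XG : Gam `<=` X.
  apply: gen_set_ind => [|g s [->|->]|g s [->|->]]; auto.
  - by exists 0%N, 0%N; rewrite !expg0 !gsimp; exact: sg1 sK.
  - by rewrite (inv _ gs_aX_p); auto.
  - by rewrite (inv _ gs_tX_p); auto.
pose r (z : 'I_p * 'I_p) := a ^+ z.1 * t ^+ z.2.
apply: (fin_idx_of_reps (r := r)) => // g /XG [i [j Kg]].
exists (inord (i %% p), inord (j %% p)).
by rewrite /r /= !inordK ?ltn_pmod // !expg_modn // ?gs_aX_p ?gs_tX_p.
Qed.

(** The section of [z1] at the letter 0 is [a^-1 * t], which moves 0; conjugates of [z1] then serve
    the other vertices of level 2. *)
Lemma gs_moves w : size w = 2%N -> exists2 k, K k & k w != w.
Proof.
move=> sw; have [g Gg gw] := gs_level_transitive (u := [:: o0; o0]) (esym sw).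
exists (z1 ^ g); first by apply: nK => //; exact: gs_K_z1.
have -> : z1 = wreath (fun i => (tau i)^-1 * tau1 i) 1.
  by rewrite /z1 gs_t1 [in LHS]gs_t_wreath wreath1V wreath1M.
rewrite -gw conjgE 2!mulgE autK (inj_eq (@aut_inj _ _)).
have aV : a^-1 [:: o0] != [:: o0].
  apply/eqP => e; have := autKV a [:: o0]; rewrite e gs_a_letter.
  by move=> /(congr1 (fun w => val (head o0 w))); rewrite /= modn_small.
rewrite /= perm1 /tau1 !tauE !val_ord_pred /= eqxx.
by have [j ej] := aut_letter a^-1 o0; move: aV; rewrite ej gs_t_letter eqseq_cons eqxx.
Qed.

Lemma gs_branching : branching Gam K 2 2.
Proof.
split => //.
- by move=> g i; exact: gs_self_similar.
- exact: gs_K_sub.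
- exact: gs_finite_index.
- by move=> i k; exact: gs_K_emb.
- by move=> w k sw Kk P sP PC; exact: (gs_comm sw Kk sP PC).
- exact: gs_moves.
Qed.

End GuptaSidkiGroup.

Theorem gupta_sidki_irs_cosofic (R : realType) (p : nat)
  (mu : probability (BorelSub (GuptaSidki p)) R) : (3 <= p)%N -> is_IRS mu -> cosofic mu.
Proof.
case: p mu => [|[|[|n]]] // mu _.
have cnt : exists e : nat -> GuptaSidki n.+3, forall c, exists k, e k = c.
  apply: (@gen_set_countable _ _ [:: gs_a n.+3; gs_t n.+3]) => g [->|->].
    by exists 0%N.
  by exists 1%N.
apply: (irs_cosofic cnt (gs_branching n) (gs_spinal_sets n) (@gs_level_transitive n)).
Qed.

Theorem theorem1p7 (R : realType) :
  (forall mu : probability (BorelSub Grigorchuk) R, is_IRS mu -> cosofic mu) /\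
  (forall p : nat, prime p -> leq 3 p ->
     forall mu : probability (BorelSub (GuptaSidki p)) R,
       is_IRS mu -> cosofic mu).
Proof.
split=> [mu|p _ p3 mu]; first exact: grigorchuk_irs_cosofic.
exact: gupta_sidki_irs_cosofic.
Qed.
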